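(* Let $\mathscr{K}:[-1,1]^d\times[-1,1]^d\to\mathbb{R}$ be a smooth kernel. If $\widehat X$ and $\widehat Y$ are constructed following the Skeletonized Interpolation algorithm (described in the context), then there exists a polynomial $r(r_0,r_1)$ such that for any $x\in[-1,1]^d$ and $y\in[-1,1]^d$, $$\left|\mathscr{K}(x,y)-\mathscr{K}(x,\widehat Y)\,\mathscr{K}(\widehat X,\widehat Y)^{-1}\,\mathscr{K}(\widehat X,y)\right| = \mathcal{O}\big(\epsilon\, r(r_0,r_1)\big).$$
   Context: Notation. For finite sequences $A=(a_i)$, $B=(b_j)$ of points in $[-1,1]^d$, $\mathscr{K}(A,B)$ is the matrix with entries $\mathscr{K}(a_i,b_j)$; $\mathscr{K}(x,B)$ is a row vector and $\mathscr{K}(A,y)$ a column vector. $\sigma_1\ge\sigma_2\ge\dots$ denote singular values. Chebyshev grids and weights. The $N$ Chebyshev nodes of the first kind on $[-1,1]$ are $\bar x_k=\cos\left(\frac{2k-1}{2N}\pi\right)$, $k=1,\dots,N$, with integration weights $w_k=\frac{\pi}{N}\sin\left(\frac{2k-1}{2N}\pi\right)$. In dimension $d$, grids are tensor products of one-dimensional grids, and the weight of a node is the product of the corresponding one-dimensional weights. Skeletonized Interpolation algorithm. (1) Build tensor grids of Chebyshev nodes $\overline X,\overline Y\subset[-1,1]^d$ such that polynomial interpolation at these nodes approximates $\mathscr{K}$ with error $\delta$ uniformly: $\mathscr{K}(x,y)=S(x,\overline X)\mathscr{K}(\overline X,\overline Y)T(y,\overline Y)^\top+E_{\mathrm{INT}}(x,y)$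 with $E_{\mathrm{INT}}=\mathcal{O}(\delta)$ on $[-1,1]^d\times[-1,1]^d$. Here $S(x,\overline X)$, $T(y,\overline Y)$ are the row vectors of tensor-product Lagrange polynomial basis functions on $\overline X$, $\overline Y$. Set $r_0=\min(|\overline X|,|\overline Y|)$. (2) Form $K_w=\mathrm{diag}(\overline W_X)^{1/2}\,\mathscr{K}(\overline X,\overline Y)\,\mathrm{diag}(\overline W_Y)^{1/2}$, where $\mathrm{diag}(\overline W_X)$, $\mathrm{diag}(\overline W_Y)$ are the diagonal matrices of the weights of $\overline X$, $\overline Y$. (3) Select $\widehat Y\subseteq\overline Y$ by a strong rank-revealing QR factorization of $K_w$, and $\widehat X\subseteq\overline X$ by a strong rank-revealing QR factorization of $K_w^\top$, both up to accuracy $\epsilon$. If the two sets differ in size, the smaller is extended to the size of the larger. Set $r_1=|\widehat X|=|\widehat Y|$. Meaning of $\epsilon$. Let $\widehat K_w$ be the submatrix of $K_w$ with rows $\widehat X$ and columns $\widehat Y$. With the selected rows and columns ordered first, the strong rank-revealing selection gives $$K_w=\begin{bmatrix} I\\ \check S\end{bmatrix}\widehat K_w\begin{bmatrix} I & \check T^\top\end{bmatrix}+E_{\mathrm{QR}},\qquad \epsilon=\|E_{\mathrm{QR}}\|_2\le p(r_0,r_1)\,\sigma_{r_1+1}(K_w),$$ with $\|\check S\|_2,\|\check T\|_2\le p(r_0,r_1)$ and $\|\widehat K_w^{-1}\|_2\le p(r_0,r_1)^2/\epsilon$, where $p$ is a slowly growing polynomial. Standing assumption: $\delta<\epsilon$.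 *)

(* Defs.v *)
From HB Require Import structures.
From mathcomp Require Import all_boot all_order all_algebra polyXY.
From mathcomp.real_closed Require Import complex.
From mathcomp Require Import all_classical all_reals all_analysis.

Set Implicit Arguments.
Unset Strict Implicit.
Unset Printing Implicit Defensive.

Import Order.TTheory GRing.Theory Num.Theory.
Import numFieldNormedType.Exports.

Local Open Scope classical_set_scope.
Local Open Scope ring_scope.

(** * Smooth kernels on the cube *)

Definition cube (R : realType) (d : nat) : set 'rV[R]_d :=
  [set x | forall i, -1 <= x 0 i <= 1].
Arguments cube : clear implicits.

(* Class C^n: all iterated directional derivatives of order at most n exist
   and are continuous at the points of the open set U. *)
Fixpoint Cn_on (R : realType) (V : normedModType R) (U : set V) (n : nat)
    (f : V -> R) : Prop :=
  (forall x, U x -> {for x, continuous f}) /\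
  (if n is n'.+1 then
     forall v, (forall x, U x -> derivable f x v) /\
               Cn_on U n' (fun x => 'D_v f x)
   else True).

(* Only the values of K on cube * cube matter. Smoothness on this closed set
   means that K is there the restriction of a function that is C^oo on an open
   neighbourhood. *)
Definition smooth_kernel (R : realType) (d : nat)
    (K : 'rV[R]_d -> 'rV[R]_d -> R) : Prop :=
  exists (U : set ('rV[R]_d * 'rV[R]_d)) (f : 'rV[R]_d * 'rV[R]_d -> R),
    [/\ open U,
        cube R d `*` cube R d `<=` U,
        (forall n, Cn_on U n f) &
        forall x y, cube R d x -> cube R d y -> K x y = f (x, y)].

(** * Matrix 2-norm and singular values *)

Definition vnorm2 (R : realType) (n : nat) (v : 'cV[R]_n) : R :=
  Num.sqrt (\sum_i v i 0 ^+ 2).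

Definition norm2 (R : realType) (m n : nat) (A : 'M[R]_(m, n)) : R :=
  sup [set vnorm2 (A *m v) | v in [set v : 'cV[R]_n | vnorm2 v <= 1]].

(* Square roots of the eigenvalues of A^T A, with multiplicity, in decreasing
   order. The library diagonalizes over a closed field, hence the detour
   through R[i]. When m < n the list is padded with n - m zeros. *)
Definition singular_values (R : realType) (m n : nat) (A : 'M[R]_(m, n)) :
    seq R :=
  sort (fun a b => b <= a)
    [seq Num.sqrt (complex.Re
       (spectral_diag (map_mx (real_complex R) (A^T *m A)) 0 i))
       | i : 'I_n].

(* The index starts at 1, and sigma k A = 0 when k exceeds the number of
   singular values. *)
Definition sigma (R : realType) (m n : nat) (k : nat) (A : 'M[R]_(m, n)) : R :=
  (singular_values A)`_k.-1.

(** * Chebyshev grids *)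

(* The nodes are numbered from 0: k stands for k + 1 in the usual formulas
   cos ((2k - 1) pi / 2N) and (pi / N) sin ((2k - 1) pi / 2N). *)
Definition cheb_angle (R : realType) (N k : nat) : R :=
  (2 * k + 1)%:R / (2 * N)%:R * pi.

Definition cheb_node (R : realType) (N k : nat) : R := cos (cheb_angle R N k).

Definition cheb_weight (R : realType) (N k : nat) : R :=
  pi / N%:R * sin (cheb_angle R N k).

Definition lagrange1 (R : realType) (N k : nat) (t : R) : R :=
  \prod_(j < N | j != k :> nat)
    ((t - cheb_node R N j) / (cheb_node R N k - cheb_node R N j)).

(* Multi-indices of the tensor grid with n i nodes in the i-th direction. *)
Definition grid_index (d : nat) (n : 'I_d -> nat) : finType :=
  {dffun forall i : 'I_d, 'I_(n i)}.

Definition grid_size (d : nat) (n : 'I_d -> nat) : nat := #|grid_index n|.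

Definition grid_point (R : realType) (d : nat) (n : 'I_d -> nat)
    (a : 'I_(grid_size n)) : 'rV[R]_d :=
  \row_i cheb_node R (n i) ((enum_val a : grid_index n) i).

Definition grid_weight (R : realType) (d : nat) (n : 'I_d -> nat) :
    'rV[R]_(grid_size n) :=
  \row_a \prod_i cheb_weight R (n i) ((enum_val a : grid_index n) i).

Definition lagrange_row (R : realType) (d : nat) (n : 'I_d -> nat)
    (x : 'rV[R]_d) : 'rV[R]_(grid_size n) :=
  \row_a \prod_i lagrange1 (n i) ((enum_val a : grid_index n) i) (x 0 i).

(** * Skeletonized interpolation *)

Definition kernel_mx (R : realType) (d : nat) (K : 'rV[R]_d -> 'rV[R]_d -> R)
    (m n : nat) (A : 'I_m -> 'rV[R]_d) (B : 'I_n -> 'rV[R]_d) : 'M[R]_(m, n) :=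
  \matrix_(i, j) K (A i) (B j).

Definition interp_error (R : realType) (d : nat)
    (K : 'rV[R]_d -> 'rV[R]_d -> R) (nX nY : 'I_d -> nat) (x y : 'rV[R]_d) : R :=
  K x y - (lagrange_row nX x
           *m kernel_mx K (@grid_point R d nX) (@grid_point R d nY)
           *m (lagrange_row nY y)^T) 0 0.

Definition weighted_kernel_mx (R : realType) (d : nat)
    (K : 'rV[R]_d -> 'rV[R]_d -> R) (nX nY : 'I_d -> nat) :
    'M[R]_(grid_size nX, grid_size nY) :=
  diag_mx (map_mx Num.sqrt (grid_weight R nX))
  *m kernel_mx K (@grid_point R d nX) (@grid_point R d nY)
  *m diag_mx (map_mx Num.sqrt (grid_weight R nY)).

(* Outcome of the strong rank-revealing selection in A, with accuracy eps and
   bounds given by the number q. The bijections sX and sY enumerate the rows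
   and the columns of A, the r selected ones first. *)
Definition strong_rr_selection (R : realType) (M N : nat) (A : 'M[R]_(M, N))
    (q eps : R) (r m n : nat) (sX : 'I_(r + m) -> 'I_M)
    (sY : 'I_(r + n) -> 'I_N) : Prop :=
  let B := mxsub sX sY A in
  let Ahat := ulsubmx B in
  [/\ bijective sX, bijective sY &
      exists (S : 'M[R]_(m, r)) (T : 'M[R]_(n, r)) (E : 'M[R]_(r + m, r + n)),
        [/\ B = col_mx 1%:M S *m Ahat *m row_mx 1%:M T^T + E,
            eps = norm2 E /\ eps <= q * sigma r.+1 A,
            norm2 S <= q /\ norm2 T <= q &
            Ahat \in unitmx /\ norm2 (invmx Ahat) <= q ^+ 2 / eps]].

(* The points selected by an enumeration that lists them first. *)
Definition selected_points (R : realType) (d : nat) (n : 'I_d -> nat)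
    (r m : nat) (s : 'I_(r + m) -> 'I_(grid_size n)) : 'I_r -> 'rV[R]_d :=
  fun i => grid_point R (s (lshift m i)).

(* Main.v *)
Require Import Defs.
From HB Require Import structures.
From mathcomp Require Import all_boot all_order all_algebra polyXY.
From mathcomp Require Import all_classical all_reals all_analysis.
From mathcomp Require Import ring lra zify.

(* Write K_w = [I; S] A [I T^T] + E for the selected block A, and K(x, y) as the
   bilinear form of K_w in the weighted Lagrange vectors s(x), t(y), up to the
   interpolation error. Expanding, the error of the skeleton is a sum of
   products in which |A^-1| <= q^2 / eps, when it occurs, comes with two factors
   among E and the interpolation error, each of which is O(eps). This gives eps
   times a polynomial in q, r1, |s| and |t|; the vectors s and t are
   polynomially bounded in |X| and |Y|, by discrete orthogonality of cosines.

   The bound may involve r0 = min (|X|, |Y|) but not the maximum. Now the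
   entries of A are O((|X| |Y|)^(-1/2)), so that
   |K_w| <= O((1 + q)^2 r1 (|X| |Y|)^(-1/2)) + eps, while a compactness argument
   shows that |K_w| >= c > 0 uniformly over the grids where K does not vanish.
   Hence either eps is bounded below, and a trivial bound is enough, or
   |X| |Y| = O(((1 + q) (1 + r1))^4). *)

Set Implicit Arguments.
Unset Strict Implicit.
Unset Printing Implicit Defensive.

Import Order.TTheory GRing.Theory Num.Theory.
Import numFieldNormedType.Exports.
Local Open Scope ring_scope.

(** * Dirichlet kernel and Chebyshev polynomials *)

Section Trigonometry.
Context {R : realType}.
Implicit Types (x y a : R) (n k : nat).

(** Induction by the addition formula, cosines being at most 1 in absolute value. It serves to bound
    [sin] from below at the Chebyshev angles. *)
Lemma norm_sin_natmul n x : `|sin (n%:R * x)| <= n%:R * `|sin x|.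
Proof.
elim: n => [|n IHn]; first by rewrite !mul0r sin0 normr0.
rewrite -addn1 natrD !mulrDl !mul1r sinD.
apply: le_trans (ler_normD _ _) _; rewrite !normrM; apply: lerD.
  apply: le_trans IHn; apply: ler_piMr; rewrite // ler_norml.
  by rewrite cos_geN1 cos_le1.
by apply: ler_piMl; rewrite // ler_norml cos_geN1 cos_le1.
Qed.

Lemma sin_natmul_pi n : sin (n%:R * pi) = 0 :> R.
Proof.
elim: n => [|n IHn]; first by rewrite mul0r sin0.
by rewrite -addn1 natrD mulrDl mul1r sinD IHn sinpi mul0r mulr0 addr0.
Qed.

Lemma cos_natmul_pi n : cos (n%:R * pi) = (-1) ^+ n :> R.
Proof.
elim: n => [|n IHn]; first by rewrite mul0r cos0.
by rewrite -addn1 natrD mulrDl mul1r cosD IHn sinpi cospi mulr0 subr0 exprD.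
Qed.

(* The argument is half of the usual angle. *)
Definition dirichlet n x : R :=
  1 + 2 * \sum_(j < n) cos (j.+1%:R * (2 * x)).

(** Multiplied by [2 * sin x], each cosine becomes a difference of sines at consecutive odd
    multiples of [x], and the sum telescopes. *)
Lemma dirichletE n x : dirichlet n x * sin x = sin ((2 * n + 1)%:R * x).
Proof.
rewrite /dirichlet; elim: n => [|n IHn].
  by rewrite big_ord0 mulr0 addr0 !mul1r.
rewrite big_ord_recr /= mulrDr addrA mulrDl IHn.
have -> : (2 * n + 1)%:R * x = n.+1%:R * (2 * x) - x.
  by rewrite -(natr1 n) natrD natrM; ring.
have -> : (2 * n.+1 + 1)%:R * x = n.+1%:R * (2 * x) + x.
  by rewrite natrD natrM -(natr1 n); ring.
by rewrite sinB sinD; ring.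
Qed.

Lemma dirichletN n x : dirichlet n (- x) = dirichlet n x.
Proof.
congr (1 + 2 * _); apply: eq_bigr => j _.
by rewrite -[RHS]cosN; congr cos; ring.
Qed.

Lemma dirichlet0 n : dirichlet n 0 = (2 * n + 1)%:R.
Proof.
rewrite /dirichlet (eq_bigr (fun=> 1)); last by move=> j _; rewrite !mulr0 cos0.
by rewrite sumr_const card_ord natrD natrM addrC.
Qed.

(** At such a point [x] one has [(2n + 1) x = m pi - x], so that the sine in [dirichletE] is [sin x]
    up to sign, and [sin x > 0] can be cancelled. *)
Lemma dirichlet_grid n m : (0 < m < 2 * n.+1)%N ->
  dirichlet n (m%:R * pi / (2 * n.+1)%:R) = - (-1) ^+ m.
Proof.
move=> /andP[m_gt0 m_lt]; set x := _ / _.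
have N0 : (2 * n.+1)%:R != 0 :> R by rewrite pnatr_eq0.
have Npos : 0 < (2 * n.+1)%:R :> R by rewrite ltr0n.
have sx : 0 < sin x.
  apply: sin_gt0_pi; rewrite /x ltr_pdivlMr ?ltr_pdivrMr //.
  by rewrite mul0r mulr_gt0 ?pi_gt0 ?ltr0n //= mulrC ltr_pM2l ?pi_gt0 // ltr_nat.
apply: (mulIf (lt0r_neq0 sx)); rewrite dirichletE.
have -> : (2 * n + 1)%:R * x = m%:R * pi - x.
  rewrite /x; have -> : (2 * n + 1)%:R = (2 * n.+1)%:R - 1 :> R.
    by apply/eqP; rewrite eq_sym subr_eq natr1 addn1 mulnS.
  by field.
by rewrite sinB sin_natmul_pi cos_natmul_pi mul0r sub0r mulNr.
Qed.

Lemma dirichlet_prod n x y :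
  1 + 2 * (\sum_(j < n) cos (j.+1%:R * x) * cos (j.+1%:R * y))
  = 2^-1 * (dirichlet n ((x - y) / 2) + dirichlet n ((x + y) / 2)).
Proof.
rewrite /dirichlet.
have E : \sum_(j < n) cos (j.+1%:R * (2 * ((x - y) / 2)))
  + \sum_(j < n) cos (j.+1%:R * (2 * ((x + y) / 2)))
  = 2 * \sum_(j < n) cos (j.+1%:R * x) * cos (j.+1%:R * y) :> R.
  rewrite -big_split mulr_sumr; apply: eq_bigr => j _ /=.
  have -> : 2 * ((x - y) / 2) = x - y by field.
  have -> : 2 * ((x + y) / 2) = x + y by field.
  by rewrite mulrBr mulrDr cosB cosD; ring.
rewrite -E; set u := \sum_(j < n) _; set v := \sum_(j < n) _.
by rewrite [_ + _ in RHS](_ : _ = 2 * (1 + (u + v))) ?mulKf //; ring.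
Qed.

Fixpoint chebyshev n : {poly R} :=
  match n with
  | 0 => 1
  | 1 => 'X
  | (n''.+1 as n').+1 => 2 *: 'X * chebyshev n' - chebyshev n''
  end.

Lemma chebyshevS n :
  chebyshev n.+2 = 2 *: 'X * chebyshev n.+1 - chebyshev n.
Proof. by []. Qed.

Lemma chebyshev_cos n x : (chebyshev n).[cos x] = cos (n%:R * x).
Proof.
suff: (chebyshev n).[cos x] = cos (n%:R * x)
   /\ (chebyshev n.+1).[cos x] = cos (n.+1%:R * x) by case.
elim: n => [|n [IH0 IH1]]; first by rewrite /= hornerC hornerX mul0r cos0 mul1r.
split=> //; rewrite chebyshevS !hornerE IH0 IH1.
have -> : n%:R * x = n.+1%:R * x - x by rewrite -addn1 natrD; ring.
have -> : n.+2%:R * x = n.+1%:R * x + x by rewrite -(addn1 n.+1) natrD; ring.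
by rewrite cosB cosD; ring.
Qed.

Lemma size_chebyshev n : (size (chebyshev n) <= n.+1)%N.
Proof.
suff: (size (chebyshev n) <= n.+1)%N /\ (size (chebyshev n.+1) <= n.+2)%N by case.
elim: n => [|n [IH0 IH1]]; first by rewrite /= size_poly1 size_polyX.
split=> //; rewrite chebyshevS; apply: leq_trans (size_polyD _ _) _.
rewrite size_polyN geq_max (leq_trans IH0) ?andbT; last by rewrite ltnW.
apply: leq_trans (size_polyMleq _ _) _.
have h : (size (2 *: 'X : {poly R}) <= 2)%N.
  by apply: leq_trans (size_scale_leq _ _) _; rewrite size_polyX.
by have := leq_add h IH1; case: (_ + _)%N.
Qed.

End Trigonometry.

Arguments chebyshev : simpl never.

(** * One-dimensional Chebyshev grids *)

Section ChebyshevNodes.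
Context {R : realType} (N : nat) (N_gt0 : (0 < N)%N).

Local Notation angle k := (cheb_angle R N k).
Local Notation node k := (cheb_node R N k).
Local Notation weight k := (cheb_weight R N k).

Let N0 : N%:R != 0 :> R. Proof. by rewrite pnatr_eq0 -lt0n. Qed.
Let Npos : 0 < N%:R :> R. Proof. by rewrite ltr0n. Qed.

Let angleE k : angle k = (2 * k%:R + 1) / (2 * N%:R) * pi.
Proof. by rewrite /cheb_angle natrD !natrM. Qed.

Lemma cheb_angle_itv k : (k < N)%N -> 0 < angle k < pi.
Proof.
move=> kN; have N2 : 0 < (2 * N)%:R :> R by rewrite ltr0n muln_gt0.
rewrite /cheb_angle addn1 mulr_gt0 ?pi_gt0 ?divr_gt0 ?ltr0n ?muln_gt0 //=.
rewrite -[ltRHS]mul1r ltr_pM2r ?pi_gt0 // ltr_pdivrMr // mul1r ltr_nat.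
by lia.
Qed.

Lemma sin_cheb_angle_gt0 k : (k < N)%N -> 0 < sin (angle k).
Proof. by move=> /cheb_angle_itv; exact: sin_gt0_pi. Qed.

(** [N] times the angle is [k pi + pi / 2], where the sine is 1 or -1; [norm_sin_natmul] then
    applies. *)
Lemma sin_cheb_angle_ge k : (k < N)%N -> N%:R^-1 <= sin (angle k).
Proof.
move=> kN; have := norm_sin_natmul N (angle k).
have -> : N%:R * angle k = k%:R * pi + pi / 2.
  by rewrite angleE; field.
rewrite sinD sin_natmul_pi cos_natmul_pi sin_pihalf mul0r add0r mulr1.
rewrite normrX normrN1 expr1n (gtr0_norm (sin_cheb_angle_gt0 kN)).
by rewrite -ler_pdivrMl // mulr1.
Qed.

Lemma cheb_node_inj j k : (j < N)%N -> (k < N)%N -> node j = node k -> j = k.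
Proof.
move=> jN kN /cos_inj; rewrite !in_itv /=.
have /andP[/ltW-> /ltW->] := cheb_angle_itv jN.
have /andP[/ltW-> /ltW->] := cheb_angle_itv kN.
move=> /(_ isT isT); rewrite /cheb_angle => /(mulIf (lt0r_neq0 (pi_gt0 R))).
have N2 : (2 * N)%:R^-1 != 0 :> R by rewrite invr_eq0 pnatr_eq0 muln_eq0 -lt0n.
by move=> /(mulIf N2)/eqP; rewrite eqr_nat eqn_add2r eqn_pmul2l // => /eqP.
Qed.

Lemma cheb_node_itv k : -1 <= node k <= 1.
Proof. by rewrite /cheb_node cos_geN1 cos_le1. Qed.

Lemma cheb_weight_gt0 k : (k < N)%N -> 0 < weight k.
Proof.
by move=> kN; rewrite mulr_gt0 ?divr_gt0 ?pi_gt0 ?sin_cheb_angle_gt0.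
Qed.

Lemma cheb_weight_le k : weight k <= pi / N%:R.
Proof. by rewrite ler_piMr ?sin_le1 // divr_ge0 // ltW // pi_gt0. Qed.

Lemma cheb_weight_ge k : (k < N)%N -> N%:R^-2 <= weight k.
Proof.
move=> kN; rewrite /cheb_weight expr2 invfM.
apply: ler_pM; rewrite ?invr_ge0 ?ler0n ?sin_cheb_angle_ge //.
by rewrite ler_peMl ?invr_ge0 ?ler0n // (le_trans _ (pi_ge2 R)) // ler1n.
Qed.

(** The left side is half the sum of two Dirichlet kernels, at half the difference and half the sum
    of the angles. These are grid points with numerators [|k - j|] and [k + j + 1], of opposite
    parities, so the kernels cancel; for [j = k] they add up to [(2N - 1) + 1]. *)
Lemma cheb_cos_orthogonality j k : (j < N)%N -> (k < N)%N ->
  1 + 2 * (\sum_(i < N.-1) cos (i.+1%:R * angle k) * cos (i.+1%:R * angle j))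
  = (j == k)%:R * N%:R.
Proof.
move=> jN kN; rewrite dirichlet_prod.
have N2 : (2 * N)%:R = 2 * N%:R :> R by rewrite natrM.
have EN : N.-1.+1 = N by rewrite prednK.
have Dp : dirichlet N.-1 ((angle k + angle j) / 2) = (-1) ^+ (k + j) :> R.
  have -> : (angle k + angle j) / 2
      = (k + j).+1%:R * pi / (2 * N.-1.+1)%:R.
    by rewrite EN !angleE N2 -(natr1 (k + j)) natrD; field.
  rewrite dirichlet_grid ?EN; first by rewrite exprS mulN1r opprK.
  by rewrite /=; lia.
have Dm i l : (i < l)%N -> (l < N)%N ->
    dirichlet N.-1 ((angle l - angle i) / 2) = - (-1) ^+ (l + i) :> R.
  move=> il lN; have -> : (angle l - angle i) / 2
      = (l - i)%:R * pi / (2 * N.-1.+1)%:R.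
    by rewrite EN natrB 1?ltnW // !angleE N2; field.
  rewrite dirichlet_grid ?EN; last by lia.
  by congr (- _); rewrite -signr_odd -[RHS]signr_odd oddD oddB 1?ltnW.
rewrite Dp; case: (ltngtP j k) => [jk|kj|<-].
- by rewrite Dm // addNr mulr0 mul0r.
- rewrite -dirichletN -mulNr opprB Dm // addnC addNr mulr0.
  by rewrite mul0r.
- rewrite subrr mul0r dirichlet0 addnn -signr_odd odd_double expr0.
  rewrite mul1r natr1 (_ : (2 * N.-1 + 1).+1 = (2 * N)%N) ?N2 ?mulKf //.
  by lia.
Qed.

(** The [k]-th Lagrange polynomial as a Chebyshev sum. Unlike the product, this form can be bounded
    term by term. *)
Definition lagrange_cos k : {poly R} :=
  N%:R^-1 *: (1 + 2 *: \sum_(j < N.-1)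
    (chebyshev j.+1).[node k] *: chebyshev j.+1).

Lemma size_lagrange_cos k : (size (lagrange_cos k) <= N)%N.
Proof.
apply: leq_trans (size_scale_leq _ _) _.
apply: leq_trans (size_polyD _ _) _; rewrite geq_max size_poly1 N_gt0 /=.
apply: leq_trans (size_scale_leq _ _) _.
apply: leq_trans (size_sum _ _ _) _; apply/bigmax_leqP => j _.
apply: leq_trans (size_scale_leq _ _) _.
by apply: leq_trans (size_chebyshev _) _; case: j => /=; lia.
Qed.

Lemma horner_lagrange_cos k x :
  (lagrange_cos k).[cos x] = N%:R^-1 * (1 + 2 * \sum_(i < N.-1)
     cos (i.+1%:R * angle k) * cos (i.+1%:R * x)).
Proof.
rewrite !hornerE horner_sum; congr (_ * (1 + 2 * _)); apply: eq_bigr => j _.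
by rewrite hornerZ !chebyshev_cos.
Qed.

Definition lagrange_prod k : {poly R} :=
  \prod_(j < N | j != k :> nat) ((node k - node j)^-1 *: ('X - (node j)%:P)).

Lemma size_lagrange_prod k : (k < N)%N -> (size (lagrange_prod k) <= N)%N.
Proof.
move=> kN; apply: leq_trans (size_poly_prod_leq _ _) _.
rewrite leq_subLR.
apply: (@leq_trans (\sum_(j < N | j != k :> nat) 2).+1).
  rewrite ltnS; apply: leq_sum => j _.
  by apply: leq_trans (size_scale_leq _ _) _; rewrite size_XsubC.
rewrite sum_nat_const.
have -> : #|[pred j : 'I_N | j != k :> nat]| = N.-1.
  rewrite -[RHS](_ : #|predC1 (Ordinal kN)| = _).
    by apply: eq_card => j; rewrite !inE.
  by rewrite cardC1 card_ord.
by lia.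
Qed.

Lemma horner_lagrange_prod k t : (lagrange_prod k).[t] = lagrange1 N k t.
Proof.
rewrite /lagrange_prod horner_prod /lagrange1; apply: eq_bigr => j _.
by rewrite !hornerE mulrC.
Qed.

Lemma lagrange1_node k j : (j < N)%N -> (k < N)%N ->
  lagrange1 N k (node j) = (j == k)%:R.
Proof.
move=> jN kN; rewrite /lagrange1; have [->|jk] := eqVneq j k.
  rewrite big1 // => i ik; rewrite divff // subr_eq0; apply: contra_neq ik.
  by move=> /cheb_node_inj -> //.
by rewrite (bigD1 (Ordinal jN)) //= subrr mul0r mul0r.
Qed.

(** Both sides are polynomials of degree less than [N], and they agree at the [N] distinct nodes, by
    orthogonality for the cosine sum. *)
Lemma lagrange1_cosE k t : (k < N)%N -> lagrange1 N k t = (lagrange_cos k).[t].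
Proof.
move=> kN; rewrite -horner_lagrange_prod; congr horner; apply/eqP.
rewrite -subr_eq0; apply/eqP.
apply: (@roots_geq_poly_eq0 _ _ [seq node (val j) | j <- enum 'I_N]).
- apply/allP => _ /mapP[j _ ->].
  rewrite rootE hornerD hornerN horner_lagrange_prod.
  rewrite lagrange1_node ?ltn_ord // /cheb_node.
  rewrite horner_lagrange_cos cheb_cos_orthogonality ?ltn_ord //.
  by rewrite mulrCA mulVf // mulr1 subrr.
- rewrite map_inj_in_uniq ?enum_uniq // => i j _ _ e.
  exact/val_inj/(cheb_node_inj (ltn_ord i) (ltn_ord j)).
- rewrite size_map size_enum_ord; apply: leq_trans (size_polyD _ _) _.
  by rewrite size_polyN geq_max size_lagrange_prod ?size_lagrange_cos.
Qed.

(** With [t] written as a cosine, the sum has [N - 1] terms of absolute value at most 1, and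
    [(1 + 2 (N - 1)) / N <= 2]. *)
Lemma norm_lagrange1_le k (t : R) : (k < N)%N -> -1 <= t <= 1 ->
  `|lagrange1 N k t| <= 2.
Proof.
move=> kN tI; rewrite lagrange1_cosE //.
rewrite -[t]acosK ?in_itv //= horner_lagrange_cos normrM.
rewrite gtr0_norm ?invr_gt0 // ler_pdivrMl //.
apply: le_trans (ler_normD _ _) _; rewrite normr1 normrM (ger0_norm (ler0n _ _)).
set s := \sum_(i < _) _; have : `|s| <= N.-1%:R.
  apply: le_trans (ler_norm_sum _ _ _) _.
  rewrite -[N.-1%:R](_ : \sum_(i < N.-1) 1 = _); last first.
    by rewrite sumr_const card_ord.
  apply: ler_sum => i _; rewrite normrM mulr_ile1 //;
    by rewrite ler_norml cos_geN1 cos_le1.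
have -> : N%:R = N.-1%:R + 1 :> R by rewrite natr1 prednK.
by lra.
Qed.

End ChebyshevNodes.

(** * Mass of the Chebyshev weights near a point *)

Section ChebyshevMass.
Context {R : realType}.
Implicit Types (x y h c : R).

Lemma norm_sin_le x : `|sin x| <= `|x|.
Proof.
wlog x0 : x / 0 <= x => [W|].
  case: (leP 0 x) => [/W //|/ltW x0]; rewrite -normrN -sinN -[`|x|]normrN.
  by apply: W; rewrite oppr_ge0.
have [c _] : exists2 c, c \in `[0, x] & sin x - sin 0 = cos c * (x - 0).
  apply: (@MVT_segment R sin cos) => //.
  by apply: continuous_subspaceT => z; exact: continuous_sin.
rewrite sin0 !subr0 => ->; rewrite normrM ler_piMl //.
by rewrite ler_norml cos_geN1 cos_le1.
Qed.

Lemma cosB_cosD x y : cos (x - y) - cos (x + y) = 2 * (sin x * sin y).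
Proof. by rewrite cosB cosD; ring. Qed.

Lemma cos_lipschitz x y : `|cos x - cos y| <= `|x - y|.
Proof.
have -> : cos x - cos y = 2 * (sin ((x + y) / 2) * sin ((y - x) / 2)).
  by rewrite -cosB_cosD; congr (cos _ - cos _); field.
rewrite !normrM (ger0_norm (ler0n _ _)).
have := norm_sin_le ((y - x) / 2); have := sin_max ((x + y) / 2).
rewrite normrM (distrC y) (ger0_norm (_ : 0 <= 2^-1)) ?invr_ge0 //.
have := normr_ge0 (sin ((x + y) / 2)); have := normr_ge0 (sin ((y - x) / 2)).
by nra.
Qed.

Definition clamp (lo hi t : R) :=
  if t <= lo then lo else if hi <= t then hi else t.

Lemma clamp_lo lo hi t : t <= lo -> clamp lo hi t = lo.
Proof. by rewrite /clamp => ->. Qed.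

Lemma clamp_hi lo hi t : lo <= hi -> hi <= t -> clamp lo hi t = hi.
Proof.
move=> lohi hit; rewrite /clamp hit; case: (leP t lo) => // tlo.
by apply/eqP; rewrite eq_le lohi (le_trans hit).
Qed.

Lemma clampB_le lo hi t u w : lo <= hi -> 0 <= w -> t - u <= w ->
  clamp lo hi t - clamp lo hi u <= w.
Proof.
move=> lohi w0 tuw; rewrite /clamp.
case: (leP t lo) => ?; case: (leP u lo) => ?; case: (leP hi t) => ?;
  case: (leP hi u) => ?; lra.
Qed.

(** The points [cos (k pi / N)] cut [[-1, 1]] into cells around the nodes, each no longer than the
    weight of its node. An interval near [x] of length at least [h / 2] is covered by the cells that
    meet it, and their nodes are at distance less than [h] from [x]. *)
Lemma cheb_mass_near N x h : (0 < N)%N -> -1 <= x <= 1 -> 0 < h <= 1 ->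
  pi / N%:R < h / 2 ->
  h / 2 <= \sum_(k < N | `|cheb_node R N k - x| < h) cheb_weight R N k.
Proof.
move=> N_gt0 xI hI hN.
have Npos : 0 < N%:R :> R by rewrite ltr0n.
have N0 := lt0r_neq0 Npos.
(* [[x - h / 2, x + h / 2]] cut down to [[-1, 1]]; its length is still at least [h / 2] because
   [h <= 1]. *)
pose lo := Num.max (-1) (x - h / 2); pose hi := Num.min 1 (x + h / 2).
have lohi : h / 2 <= hi - lo.
  rewrite /hi /lo.
  by case: (leP 1 (x + h / 2)); case: (leP (-1) (x - h / 2)) => *; lra.
have lo_hi : lo <= hi by lra.
have [hi1 hix] : hi <= 1 /\ hi <= x + h / 2.
  by split; rewrite /hi ge_min lexx ?orbT.
have [lo1 lox] : -1 <= lo /\ x - h / 2 <= lo.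
  by split; rewrite /lo le_max lexx ?orbT.
clearbody lo hi.
pose a k : R := k%:R * pi / N%:R.
(* [g k - g k.+1] is the length of the part of the [k]-th cell in the interval; these lengths
   telescope to the whole. *)
pose g k := clamp lo hi (cos (a k)).
apply: le_trans lohi _; have <- : clamp lo hi 1 - clamp lo hi (-1) = hi - lo.
  by rewrite clamp_hi // clamp_lo.
have -> : clamp lo hi 1 - clamp lo hi (-1) = \sum_(k < N) (g k - g k.+1).
  rewrite -(big_mkord xpredT (fun k => g k - g k.+1)).
  under eq_bigr do rewrite -opprB.
  rewrite sumrN telescope_sumr // opprB /g /a.
  by rewrite !mul0r mulrAC divff // mul1r cos0 cospi.
rewrite [leRHS]big_mkcond /=; apply: ler_sum => k _.
have kN := ltn_ord k.
have w_gt0 := cheb_weight_gt0 N_gt0 kN (R := R).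
pose hlf : R := pi / (2 * N%:R).
have hlf0 : 0 <= hlf by rewrite divr_ge0 ?pi_ge0 // mulr_ge0.
have hlf2 : hlf * 2 = pi / N%:R by rewrite /hlf; field.
have ak : a k = cheb_angle R N k - hlf.
  by rewrite /a /hlf /cheb_angle natrD !natrM; field.
have ak1 : a k.+1 = cheb_angle R N k + hlf.
  by rewrite /a /hlf /cheb_angle natrD !natrM -(natr1 k); field.
have cell : cos (a k) - cos (a k.+1) <= cheb_weight R N k.
  rewrite ak ak1 cosB_cosD /cheb_weight -hlf2.
  have := sin_cheb_angle_gt0 N_gt0 kN (R := R).
  have := le_trans (ler_norm _) (norm_sin_le hlf); rewrite (ger0_norm hlf0).
  by nra.
have near0 : `|cos (a k) - cheb_node R N k| <= hlf.
  apply: le_trans (cos_lipschitz _ _) _.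
  by rewrite ak addrAC subrr sub0r normrN ger0_norm.
have near1 : `|cos (a k.+1) - cheb_node R N k| <= hlf.
  apply: le_trans (cos_lipschitz _ _) _.
  by rewrite ak1 addrAC subrr add0r ger0_norm.
move: near0 near1; rewrite !ler_norml /g => near0 near1.
case: ifPn => [_|]; first by apply: clampB_le => //; exact: ltW.
(* The cell of a far node extends at most [pi / (2N) < h / 4] from it and misses the interval, so
   its part has length 0. *)
rewrite -leNgt ler_normr => /orP[far|far].
  by rewrite !clamp_hi ?subrr //; lra.
by rewrite !clamp_lo ?subrr //; lra.
Qed.

End ChebyshevMass.

(** * A lower bound for the mass of a kernel on tensor grids *)

Lemma uniform_pos (R : realType) (T : finType) (Q : T -> R -> Prop) :
  (forall t c c', c' <= c -> Q t c -> Q t c') ->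
  (forall t, exists2 c, 0 < c & Q t c) ->
  exists2 c, 0 < c & forall t, Q t c.
Proof.
move=> Qle Qex; suff [c c0 Qc] : exists2 c, 0 < c &
    forall t, t \in enum T -> Q t c.
  by exists c => // t; apply: Qc; rewrite mem_enum.
elim: (enum T) => [|t s [c c0 Qc]]; first by exists 1.
have [c' c'0 Qc'] := Qex t; exists (Num.min c c').
  by rewrite lt_min c0 c'0.
move=> u; rewrite inE => /orP[/eqP->|us].
  by apply: Qle Qc'; rewrite ge_min lexx orbT.
by apply: Qle (Qc u us); rewrite ge_min lexx.
Qed.

Section GridDichotomy.
Context {R : realType} {I : finType}.
Context (G : (I -> R) -> R)
  (G_cont : forall x : I -> R, (forall i, -1 <= x i <= 1) ->
  forall e : R, 0 < e -> exists2 h : R, 0 < h &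
  forall y : I -> R, (forall i, -1 <= y i <= 1) -> (forall i, `|y i - x i| < h) ->
    `|G y - G x| < e).
Implicit Types (n k : I -> nat) (J : {set I}).

Definition grid_val n k : R := G (fun i => cheb_node R (n i) (k i)).

(** The box of indices [P] is where the kernel matrix will be tested: [b] gives the sign of [G]
    there, and the product form makes the masses of the directions multiply. *)
Definition massive n (c : R) := exists (b : bool) (P : I -> pred nat),
  (forall k, (forall i, (k i < n i)%N && P i (k i)) ->
     c <= (-1) ^+ b * grid_val n k) /\
  (forall i, c <= \sum_(j < n i | P i j) cheb_weight R (n i) j).

Definition zero_or_massive n (c : R) :=
  (forall k, (forall i, (k i < n i)%N) -> grid_val n k = 0) \/ massive n c.

Lemma zero_or_massive_le n c c' : c' <= c ->
  zero_or_massive n c -> zero_or_massive n c'.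
Proof.
move=> cc [z|[b [P [H1 H2]]]]; [by left|right].
exists b, P; split=> [k kP|i].
  exact: le_trans cc (H1 k kP).
exact: le_trans cc (H2 i).
Qed.

(* The coordinates outside J have a fixed number of nodes. If G does not vanish
   at some point of the slab that they define, then the grids which are fine in
   all the directions of J see a neighbourhood of this point; the other grids
   have a bounded number of nodes in some direction of J. *)
Lemma zero_or_massive_slab J n0 : (forall i, (0 < n0 i)%N) ->
  exists2 c : R, 0 < c & forall n, (forall i, (0 < n i)%N) ->
    (forall i, i \notin J -> n i = n0 i) -> zero_or_massive n c.
Proof.
have [m] := ubnP #|J|; elim: m J n0 => // m IHm J n0 /ltnSE Jm n0_gt0.
have [[k0 [x [xI xk0 Gx]]]|noX] := pselect (exists k0 (x : I -> R),
  [/\ forall i, -1 <= x i <= 1,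
      forall i, i \notin J -> (k0 i < n0 i)%N /\ x i = cheb_node R (n0 i) (k0 i)
    & G x != 0]); last first.
  (* Every grid node is a point of the slab, so here [G] vanishes at all of them and any constant
     will do. *)
  exists 1 => // n n_gt0 nJ; left=> k kn; apply/eqP/negP => /negP Gk.
  apply: noX; exists k, (fun i => cheb_node R (n i) (k i)); split=> //.
    by move=> i; exact: cheb_node_itv.
  by move=> i iJ; rewrite -nJ.
have Gx2 : 0 < `|G x| / 2 by rewrite divr_gt0 ?normr_gt0.
have [h' h'0 Gh'] := G_cont xI Gx2.
pose h := Num.min h' 1.
have h0 : 0 < h by rewrite lt_min h'0 ltr01.
have h1 : h <= 1 by rewrite ge_min lexx orbT.
have hh' : h <= h' by rewrite ge_min lexx.
clearbody h.
have sG y : (forall i, -1 <= y i <= 1) -> (forall i, `|y i - x i| < h) ->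
    `|G x| / 2 <= (-1) ^+ (G x < 0)%R * G y.
  move=> yI yx; have := Gh' y yI (fun i => lt_le_trans (yx i) hh').
  rewrite ltr_norml; case: (ltP (G x) 0) => [Gx0|Gx0] /andP[].
    by rewrite (ltr0_norm Gx0) expr1; lra.
  by rewrite (ger0_norm Gx0) expr0; lra.
(* Beyond [N1] nodes a direction is fine enough for [cheb_mass_near] at scale [h]. *)
pose N1 := Num.Def.trunc (2 * pi / h).
have fine N : (N1 < N)%N -> pi / N%:R < h / 2.
  move=> N1N; have N0 : 0 < N%:R :> R by rewrite ltr0n (leq_trans _ N1N).
  have : 2 * pi / h < N%:R.
    by apply: lt_le_trans (truncnS_gt _) _; rewrite ler_nat.
  by rewrite !ltr_pdivrMr //; lra.
(* In the fixed directions the box will be the single index [k0 i], whose weight is bounded below by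
   [c1]. *)
have [c1 c10 Hc1] : exists2 c, 0 < c & forall i : I, i \notin J ->
    c <= cheb_weight R (n0 i) (k0 i).
  apply: (@uniform_pos R I (fun i c => i \notin J -> c <= _)).
    by move=> i c c' cc H iJ; apply: le_trans cc (H iJ).
  move=> i; have [iJ|iJ] := boolP (i \in J); first by exists 1.
  exists (cheb_weight R (n0 i) (k0 i)) => //.
  by apply: cheb_weight_gt0 => //; case: (xk0 i iJ).
(* [c2] serves the coarse grids: the induction hypothesis is taken for each direction [i] of [J] and
   each number of nodes [l <= N1], the direction [i] becoming fixed. *)
have [c2 c20 Hc2] : exists2 c, 0 < c & forall t : I * 'I_N1.+1, t.1 \in J ->
    (0 < t.2)%N -> forall n, (forall i, (0 < n i)%N) ->
    n t.1 = t.2 -> (forall i, i \notin J -> n i = n0 i) -> zero_or_massive n c.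
  apply: (@uniform_pos R (I * 'I_N1.+1)%type (fun t c => t.1 \in J ->
    (0 < t.2)%N -> forall n, (forall i, (0 < n i)%N) ->
    n t.1 = t.2 -> (forall i, i \notin J -> n i = n0 i) -> zero_or_massive n c)).
    move=> t c c' cc H tJ t0 n n_gt0 nt nJ.
    exact: zero_or_massive_le cc (H tJ t0 n n_gt0 nt nJ).
  move=> [i l] /=; have [iJ|iJ] := boolP (i \in J); last by exists 1.
  have [l0|l0] := posnP l; first by exists 1 => // _; rewrite l0.
  have [||c c0 Hc] := IHm (J :\ i) (fun j => if j == i then l : nat else n0 j).
  - by move: Jm; rewrite (cardsD1 i) iJ add1n.
  - by move=> j; case: ifP.
  exists c => // _ _ n n_gt0 ni nJ; apply: Hc => // j.
  by rewrite !inE negb_and negbK; case: eqP => [->|_ /nJ].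
exists (Num.min (Num.min (h / 2) (`|G x| / 2)) (Num.min c1 c2)).
  by rewrite !lt_min Gx2 c10 c20 divr_gt0.
move=> n n_gt0 nJ.
have [/existsP[i /andP[iJ iN]]|/existsPn coarse] :=
    boolP [exists i, (i \in J) && (n i <= N1)%N].
  have niN : (n i < N1.+1)%N by [].
  apply: (@zero_or_massive_le _ c2); first by rewrite !ge_min lexx !orbT.
  exact: (Hc2 (i, Ordinal niN) iJ (n_gt0 i) n n_gt0 erefl nJ).
right; exists (G x < 0)%R, (fun i => if i \in J then
  [pred k | `|cheb_node R (n i) k - x i| < h] else pred1 (k0 i)); split.
  move=> k kP; apply: (@le_trans _ _ (`|G x| / 2)).
    by rewrite !ge_min lexx !orbT.
  apply: sG => i; first exact: cheb_node_itv.
  have /andP[_] := kP i; case: ifPn => [//|iJ] /eqP->.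
  by rewrite nJ // (xk0 i iJ).2 subrr normr0.
move=> i; have := coarse i; case: ifPn => /= [iJ|iJ _].
  rewrite -ltnNge => niN; apply: (@le_trans _ _ (h / 2)).
    by rewrite !ge_min lexx.
  by apply: cheb_mass_near => //; [rewrite h0 h1|exact: fine].
have kn : (k0 i < n i)%N by rewrite nJ //; case: (xk0 i iJ).
rewrite (big_pred1 (Ordinal kn)) //= nJ //.
by apply: le_trans (Hc1 i iJ); rewrite !ge_min lexx !orbT.
Qed.

Lemma zero_or_massive_grid : exists2 c : R, 0 < c & forall n,
  (forall i, (0 < n i)%N) -> zero_or_massive n c.
Proof.
have [c c0 Hc] := @zero_or_massive_slab [set: I] (fun=> 1%N) (fun=> isT).
by exists c => // n n_gt0; apply: Hc => // i; rewrite inE.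
Qed.

End GridDichotomy.

(** * Tensor grids *)

(** Distributivity for dependent functions, reduced to the non-dependent case by tagging the
    values. *)
Lemma sum_prod_dffun (R : comNzRingType) (I : finType) (T : I -> finType)
    (F : forall i, T i -> R) :
  \sum_(f : {dffun forall i, T i}) \prod_i F i (f i) = \prod_i \sum_t F i t.
Proof.
rewrite (reindex (@dffun_of_fprod I T)); last exact/onW_bij/dffun_of_fprod_bij.
under eq_bigr => f _.
  have -> : \prod_i F i (dffun_of_fprod f i) = \prod_i [ffun t => F i t] (f i).
    by apply: eq_bigr => i _; rewrite !ffunE.
  over.
rewrite (big_fprod 1 _ (fun i => [ffun t => F i t])) /=.
rewrite -(bigA_distr_big_dep _ (fun i u => untag 0 [ffun t => F i t] u)).
apply: eq_bigr => i _.
rewrite -(big_tag (fun i t => [ffun t => F i t] t) i).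
by apply: eq_bigr => t _; rewrite ffunE.
Qed.

Section Grid.
Context {R : realType} {d : nat} (n : 'I_d -> nat)
  (n_gt0 : forall i, (0 < n i)%N).
Implicit Types (a : 'I_(grid_size n)) (x : 'rV[R]_d).

Definition grid_coord a i : nat := (enum_val a : grid_index n) i.

Lemma grid_coord_lt a i : (grid_coord a i < n i)%N.
Proof. exact: ltn_ord. Qed.

Lemma sum_grid_prod (F : 'I_d -> nat -> R) :
  \sum_a \prod_i F i (grid_coord a i) = \prod_i \sum_(j < n i) F i j.
Proof.
rewrite -(sum_prod_dffun (fun i (j : 'I_(n i)) => F i j)).
by rewrite [RHS](reindex _ (onW_bij _ (enum_val_bij _))).
Qed.

Lemma grid_sizeE : (grid_size n)%:R = \prod_i (n i)%:R :> R.
Proof.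
transitivity (\sum_(a < grid_size n) \prod_(i < d) (1 : R)).
  by rewrite (eq_bigr (fun=> 1)) ?sumr_const ?card_ord // => a _; rewrite big1.
rewrite (sum_grid_prod (fun _ _ => 1)); apply: eq_bigr => i _.
by rewrite sumr_const card_ord.
Qed.

Lemma grid_size_gt0 : (0 < grid_size n)%N.
Proof.
by rewrite -(ltr0n R) grid_sizeE prodr_gt0 // => i _; rewrite ltr0n.
Qed.

Lemma cube_grid_point a : cube R d (grid_point R a).
Proof. by move=> i; rewrite mxE; exact: cheb_node_itv. Qed.

Lemma grid_weightE a :
  grid_weight R n 0 a = \prod_i cheb_weight R (n i) (grid_coord a i).
Proof. by rewrite mxE. Qed.

Lemma grid_weight_gt0 a : 0 < grid_weight R n 0 a.
Proof.
rewrite grid_weightE prodr_gt0 // => i _.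
exact (cheb_weight_gt0 (n_gt0 i) (grid_coord_lt a i)).
Qed.

Lemma grid_weight_le a : grid_weight R n 0 a <= pi ^+ d / (grid_size n)%:R.
Proof.
rewrite grid_weightE grid_sizeE -prodfV.
have -> : pi ^+ d = \prod_(i < d) pi :> R by rewrite prodr_const card_ord.
rewrite -big_split; apply: ler_prod => i _; rewrite cheb_weight_le // andbT.
exact (ltW (cheb_weight_gt0 (n_gt0 i) (grid_coord_lt a i))).
Qed.

Lemma grid_weight_ge a : (grid_size n)%:R ^- 2 <= grid_weight R n 0 a.
Proof.
rewrite grid_weightE grid_sizeE -prodrXl -prodfV; apply: ler_prod => i _.
rewrite invr_ge0 exprn_ge0 ?ler0n //=.
exact (cheb_weight_ge (n_gt0 i) (grid_coord_lt a i)).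
Qed.

Lemma sum_grid_weight_le : \sum_a grid_weight R n 0 a <= pi ^+ d.
Proof.
have sz : (grid_size n)%:R != 0 :> R by rewrite pnatr_eq0 -lt0n grid_size_gt0.
apply: (@le_trans _ _ (\sum_a pi ^+ d / (grid_size n)%:R)).
  by apply: ler_sum => a _; exact: grid_weight_le.
by rewrite sumr_const card_ord -[leLHS]mulr_natr divfK.
Qed.

Lemma norm_lagrange_row_le x a : cube R d x ->
  `|lagrange_row n x 0 a| <= 2 ^+ d.
Proof.
move=> xI; rewrite mxE normr_prod.
have -> : 2 ^+ d = \prod_(i < d) 2 :> R by rewrite prodr_const card_ord.
apply: ler_prod => i _; rewrite normr_ge0 /=.
exact (norm_lagrange1_le (n_gt0 i) (grid_coord_lt a i) (xI i)).
Qed.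

End Grid.

(** * Euclidean and operator norms *)

Section Norms.
Context {R : realType}.

Lemma vnorm2_ge0 n (v : 'cV[R]_n) : 0 <= vnorm2 v.
Proof. exact: sqrtr_ge0. Qed.

Lemma sqr_vnorm2 n (v : 'cV[R]_n) : vnorm2 v ^+ 2 = \sum_i v i 0 ^+ 2.
Proof. by rewrite sqr_sqrtr // sumr_ge0 // => i _; rewrite sqr_ge0. Qed.

Lemma vnorm2_le n (v : 'cV[R]_n) c : 0 <= c -> \sum_i v i 0 ^+ 2 <= c ^+ 2 ->
  vnorm2 v <= c.
Proof.
move=> c0 vc.
by rewrite -(@ler_pXn2r _ 2) ?nnegrE ?vnorm2_ge0 // sqr_vnorm2.
Qed.

Lemma vnorm2_eq0 n (v : 'cV[R]_n) : vnorm2 v = 0 -> v = 0.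
Proof.
move=> v0; apply/matrixP => i j; rewrite ord1 mxE; apply/eqP.
rewrite -sqrf_eq0; move/eqP: (sqr_vnorm2 v); rewrite v0 expr0n eq_sym.
rewrite psumr_eq0 => [/allP/(_ i)|k _]; last exact: sqr_ge0.
by rewrite mem_index_enum => /(_ isT).
Qed.

Lemma vnorm2Z n c (v : 'cV[R]_n) : vnorm2 (c *: v) = `|c| * vnorm2 v.
Proof.
rewrite /vnorm2 -sqrtr_sqr -sqrtrM ?sqr_ge0 // mulr_sumr.
by congr Num.sqrt; apply: eq_bigr => i _; rewrite mxE exprMn.
Qed.

Lemma vnorm2_0 n : vnorm2 (0 : 'cV[R]_n) = 0.
Proof. by rewrite -(scale0r 0) vnorm2Z normr0 mul0r. Qed.

(** The sum of the squares [(b * f i - s * a * g i) ^+ 2], with [s] equal to 1 or -1, is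
    nonnegative; expanding gives the bound multiplied by [a * b]. If [a * b = 0], one of the two
    families vanishes. *)
Lemma cauchy_schwarz_sum n (f g : 'I_n -> R) (a b : R) : 0 <= a -> 0 <= b ->
  \sum_i f i ^+ 2 = a ^+ 2 -> \sum_i g i ^+ 2 = b ^+ 2 ->
  `|\sum_i f i * g i| <= a * b.
Proof.
move=> a0 b0 fa gb.
have key (s : R) : s ^+ 2 = 1 -> s * (\sum_i f i * g i) * (a * b) <= (a * b) ^+ 2.
  move=> s1; have : 0 <= \sum_i (b * f i - s * a * g i) ^+ 2.
    by apply: sumr_ge0 => i _; exact: sqr_ge0.
  have -> : \sum_i (b * f i - s * a * g i) ^+ 2 =
      b ^+ 2 * (\sum_i f i ^+ 2) + (s * a) ^+ 2 * (\sum_i g i ^+ 2)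
      - 2 * s * a * b * (\sum_i f i * g i).
    rewrite !mulr_sumr -big_split -sumrB.
    by apply: eq_bigr => i _ /=; ring.
  by rewrite fa gb exprMn s1; lra.
have [ab0|ab0] := eqVneq (a * b) 0; last first.
  have abp : 0 < a * b by rewrite lt_neqAle eq_sym ab0 mulr_ge0.
  rewrite ler_norml -lerNl -mulN1r -[X in _ && (X <= _)]mul1r.
  apply/andP; split; rewrite -(ler_pM2r abp) -expr2 key //;
    by rewrite ?sqrrN expr1n.
rewrite ab0 normr_le0; apply/eqP/big1 => i _; move/eqP: ab0.
have z (h : 'I_n -> R) : \sum_i h i ^+ 2 = 0 -> h i = 0.
  move=> /eqP; rewrite psumr_eq0 => [/allP/(_ i)|k _]; last exact: sqr_ge0.
  by rewrite mem_index_enum sqrf_eq0 => /(_ isT)/eqP.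
rewrite mulf_eq0 => /orP[] /eqP e0.
  by rewrite (z f) ?mul0r // fa e0 expr0n.
by rewrite (z g) ?mulr0 // gb e0 expr0n.
Qed.

Lemma cauchy_schwarz n (u : 'rV[R]_n) (v : 'cV[R]_n) :
  `|(u *m v) 0 0| <= vnorm2 u^T * vnorm2 v.
Proof.
rewrite mxE; apply: cauchy_schwarz_sum; rewrite ?vnorm2_ge0 ?sqr_vnorm2 //.
by apply: eq_bigr => i _; rewrite mxE.
Qed.

Lemma vnorm2D n (u v : 'cV[R]_n) : vnorm2 (u + v) <= vnorm2 u + vnorm2 v.
Proof.
apply: vnorm2_le; first by rewrite addr_ge0 ?vnorm2_ge0.
have := cauchy_schwarz u^T v; rewrite trmxK => /(le_trans (ler_norm _)).
rewrite mxE (eq_bigr (fun i => u i 0 * v i 0)) => [cs|i _]; last by rewrite mxE.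
rewrite sqrrD !sqr_vnorm2.
rewrite (eq_bigr (fun i => u i 0 ^+ 2 + v i 0 ^+ 2 + 2 * (u i 0 * v i 0))).
  by rewrite !big_split /= -mulr_sumr; move: cs; lra.
by move=> i _; rewrite mxE; ring.
Qed.

Definition frobenius m n (A : 'M[R]_(m, n)) :=
  Num.sqrt (\sum_i \sum_j A i j ^+ 2).

Lemma vnorm2_mulmx_frobenius m n (A : 'M[R]_(m, n)) (v : 'cV_n) :
  vnorm2 (A *m v) <= frobenius A * vnorm2 v.
Proof.
apply: vnorm2_le; first by rewrite mulr_ge0 ?sqrtr_ge0 ?vnorm2_ge0.
rewrite exprMn sqr_sqrtr; last first.
  by apply: sumr_ge0 => i _; apply: sumr_ge0 => j _; exact: sqr_ge0.
rewrite mulr_suml; apply: ler_sum => i _.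
have := cauchy_schwarz (row i A) v; rewrite -row_mul mxE => cs.
rewrite -real_normK ?num_real //.
apply: (@le_trans _ _ ((vnorm2 (row i A)^T * vnorm2 v) ^+ 2)).
  by rewrite ler_sqr ?nnegrE ?mulr_ge0 ?vnorm2_ge0.
rewrite exprMn sqr_vnorm2.
rewrite ler_wpM2r ?sqr_ge0 //; apply: ler_sum => j _.
by rewrite !mxE.
Qed.

(** The [sup] in [norm2] is meaningful only for a nonempty bounded set; the Frobenius norm is a
    bound. *)
Lemma norm2_has_sup m n (A : 'M[R]_(m, n)) :
  has_sup [set vnorm2 (A *m v) | v in [set v : 'cV[R]_n | vnorm2 v <= 1]]%classic.
Proof.
split; first by exists (vnorm2 (A *m 0)), 0 => //=; rewrite vnorm2_0.
exists (frobenius A) => _ [v /= v1 <-].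
apply: le_trans (vnorm2_mulmx_frobenius A v) _.
by rewrite ler_piMr ?sqrtr_ge0.
Qed.

Lemma norm2_le m n (A : 'M[R]_(m, n)) c : 0 <= c ->
  (forall v, vnorm2 (A *m v) <= c * vnorm2 v) -> norm2 A <= c.
Proof.
move=> c0 Ac; apply: ge_sup; first by case: (norm2_has_sup A).
by move=> _ [v /= v1 <-]; apply: le_trans (Ac v) _; rewrite ler_piMr.
Qed.

Lemma norm2_ge0 m n (A : 'M[R]_(m, n)) : 0 <= norm2 A.
Proof.
apply: le_trans (vnorm2_ge0 (A *m 0)) _; apply: sup_upper_bound.
  exact: norm2_has_sup.
by exists 0 => //=; rewrite vnorm2_0.
Qed.

Lemma vnorm2_mulmx m n (A : 'M[R]_(m, n)) (v : 'cV_n) :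
  vnorm2 (A *m v) <= norm2 A * vnorm2 v.
Proof.
have [/vnorm2_eq0->|v0] := eqVneq (vnorm2 v) 0.
  by rewrite mulmx0 !vnorm2_0 mulr0.
have vp : 0 < vnorm2 v by rewrite lt_neqAle eq_sym v0 vnorm2_ge0.
rewrite -ler_pdivrMr // mulrC -[_^-1]gtr0_norm ?invr_gt0 // -vnorm2Z.
rewrite scalemxAr; apply: sup_upper_bound; first exact: norm2_has_sup.
exists ((vnorm2 v)^-1 *: v) => //=.
by rewrite vnorm2Z gtr0_norm ?invr_gt0 // mulVf.
Qed.

(** [|A^T u|^2 = u^T A (A^T u) <= |u| |A| |A^T u|], and one factor cancels. This spares a comparison
    of the norms of [A] and [A^T]. *)
Lemma vnorm2_mulmx_tr m n (A : 'M[R]_(m, n)) (u : 'cV_m) :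
  vnorm2 (A^T *m u) <= norm2 A * vnorm2 u.
Proof.
have [e|v0] := eqVneq (vnorm2 (A^T *m u)) 0.
  by rewrite e mulr_ge0 ?norm2_ge0 ?vnorm2_ge0.
have vp : 0 < vnorm2 (A^T *m u) by rewrite lt_neqAle eq_sym v0 vnorm2_ge0.
rewrite -(ler_pM2r vp) -expr2 sqr_vnorm2.
have -> : \sum_i (A^T *m u) i 0 ^+ 2 = (u^T *m (A *m (A^T *m u))) 0 0.
  rewrite mulmxA -[u^T *m A]trmxK trmx_mul trmxK [RHS]mxE.
  by apply: eq_bigr => i _; rewrite [in RHS]mxE expr2.
apply: le_trans (ler_norm _) _; apply: le_trans (cauchy_schwarz _ _) _.
rewrite trmxK mulrAC [leRHS]mulrC ler_wpM2l ?vnorm2_ge0 //.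
exact: vnorm2_mulmx.
Qed.

Lemma norm2_entries m n (A : 'M[R]_(m, n)) c : 0 <= c ->
  (forall i j, `|A i j| <= c) -> norm2 A <= Num.sqrt (m * n)%:R * c.
Proof.
move=> c0 Ac; apply: (@le_trans _ _ (frobenius A)).
  by apply: norm2_le (sqrtr_ge0 _) _ => v; exact: vnorm2_mulmx_frobenius.
rewrite -[c in leRHS](ger0_norm c0) -sqrtr_sqr -sqrtrM ?ler0n // ler_wsqrtr //.
apply: (@le_trans _ _ (\sum_(i < m) \sum_(j < n) c ^+ 2)).
  apply: ler_sum => i _; apply: ler_sum => j _.
  by rewrite -real_normK ?num_real // ler_pXn2r ?nnegrE.
by rewrite !sumr_const !card_ord -mulrnA mulr_natl mulnC.
Qed.

End Norms.

(** * The residual of a perturbed skeleton *)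

Section SkeletonResidual.
Context {R : realType} {r m n : nat}.
Variables (A : 'M[R]_r) (S : 'M[R]_(m, r)) (T : 'M[R]_(n, r)).
Variables (E : 'M[R]_(r + m, r + n)) (q eps : R).
Hypotheses (A_unit : A \in unitmx) (eps_gt0 : 0 < eps).
Hypotheses (S_le : norm2 S <= q) (T_le : norm2 T <= q) (E_le : norm2 E <= eps).
Hypothesis Ainv_le : norm2 (invmx A) <= q ^+ 2 / eps.

Let B := col_mx 1%:M S *m A *m row_mx 1%:M T^T + E.
Let q_ge0 : 0 <= q. Proof. exact: le_trans (norm2_ge0 S) S_le. Qed.

Lemma lsubmx_skeleton : lsubmx B = col_mx 1%:M S *m A + lsubmx E.
Proof. by rewrite /B raddfD /= mul_mx_row row_mxKl mulmx1. Qed.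

Lemma usubmx_skeleton : usubmx B = A *m row_mx 1%:M T^T + usubmx E.
Proof. by rewrite /B raddfD /= -mulmxA mul_col_mx col_mxKu mul1mx. Qed.

Lemma vnorm2_usubmx m1 m2 (v : 'cV[R]_(m1 + m2)) :
  vnorm2 (usubmx v) <= vnorm2 v.
Proof.
apply: vnorm2_le (vnorm2_ge0 _) _; rewrite sqr_vnorm2 big_split_ord /=.
rewrite -[leLHS]addr0; apply: lerD; first by apply: ler_sum => i _; rewrite mxE.
by apply: sumr_ge0 => i _; exact: sqr_ge0.
Qed.

Lemma vnorm2_dsubmx m1 m2 (v : 'cV[R]_(m1 + m2)) :
  vnorm2 (dsubmx v) <= vnorm2 v.
Proof.
apply: vnorm2_le (vnorm2_ge0 _) _; rewrite sqr_vnorm2 big_split_ord /=.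
rewrite -[leLHS]add0r; apply: lerD; last by apply: ler_sum => i _; rewrite mxE.
by apply: sumr_ge0 => i _; exact: sqr_ge0.
Qed.

Lemma vnorm2_row_mx1 p (X : 'M[R]_(p, r)) (v : 'cV[R]_(r + p)) :
  norm2 X <= q -> vnorm2 (row_mx 1%:M X^T *m v) <= (1 + q) * vnorm2 v.
Proof.
move=> Xq; rewrite -[v]vsubmxK mul_row_col vsubmxK mul1mx.
apply: le_trans (vnorm2D _ _) _; rewrite mulrDl mul1r; apply: lerD.
  exact: vnorm2_usubmx.
apply: le_trans (vnorm2_mulmx_tr _ _) _.
by apply: ler_pM; rewrite ?norm2_ge0 ?vnorm2_ge0 ?vnorm2_dsubmx.
Qed.

Lemma vnorm2_mul_le p1 p2 (X : 'M[R]_(p1, p2)) (v : 'cV[R]_p2) c b :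
  norm2 X <= c -> vnorm2 v <= b -> vnorm2 (X *m v) <= c * b.
Proof.
move=> Xc vb; apply: le_trans (vnorm2_mulmx _ _) _.
by apply: ler_pM; rewrite ?norm2_ge0 ?vnorm2_ge0.
Qed.

Lemma norm_form_le p (u : 'rV[R]_p) (v : 'cV[R]_p) a b :
  vnorm2 u^T <= a -> vnorm2 v <= b -> `|(u *m v) 0 0| <= a * b.
Proof.
move=> ua vb; apply: le_trans (cauchy_schwarz _ _) _.
by apply: ler_pM; rewrite ?vnorm2_ge0.
Qed.

Section Bounds.
(** [s] and [t] will be the permuted weighted Lagrange vectors; [sigma] bounds their lengths and is
    not a singular value. *)
Variables (s : 'rV[R]_(r + m)) (t : 'cV[R]_(r + n)).
Variables (sigma : R) (s_le : vnorm2 s^T <= sigma) (t_le : vnorm2 t <= sigma).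

Let sigma_ge0 : 0 <= sigma. Proof. exact: le_trans (vnorm2_ge0 _) t_le. Qed.
Let Rt_le : vnorm2 (row_mx 1%:M T^T *m t) <= (1 + q) * sigma.
Proof.
apply: le_trans (vnorm2_row_mx1 _ T_le) _.
by rewrite ler_wpM2l // addr_ge0.
Qed.
Let sL_le : vnorm2 (s *m col_mx 1%:M S)^T <= (1 + q) * sigma.
Proof.
rewrite trmx_mul tr_col_mx trmx1; apply: le_trans (vnorm2_row_mx1 _ S_le) _.
by rewrite ler_wpM2l // addr_ge0.
Qed.
Let sE_le : vnorm2 (s *m E)^T <= eps * sigma.
Proof.
rewrite trmx_mul; apply: le_trans (vnorm2_mulmx_tr _ _) _.
by apply: ler_pM; rewrite ?norm2_ge0 ?vnorm2_ge0.
Qed.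
Let sEl_le : vnorm2 (s *m lsubmx E)^T <= eps * sigma.
Proof.
apply: le_trans sE_le.
have -> : s *m E = row_mx (s *m lsubmx E) (s *m rsubmx E).
  by rewrite -mul_mx_row hsubmxK.
rewrite tr_row_mx; apply: le_trans (vnorm2_usubmx _).
by rewrite col_mxKu.
Qed.
Let Eut_le : vnorm2 (usubmx E *m t) <= eps * sigma.
Proof.
apply: (@le_trans _ _ (vnorm2 (E *m t))); last exact: vnorm2_mul_le.
have -> : E *m t = col_mx (usubmx E *m t) (dsubmx E *m t).
  by rewrite -mul_col_mx vsubmxK.
by apply: le_trans (vnorm2_usubmx _); rewrite col_mxKu.
Qed.

(** Read backwards, a form bounded below forces [norm2 A] or [eps] to be large; this is how
    [grid_sizes_le] uses it. *)
Lemma norm_form_B_le :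
  `|(s *m B *m t) 0 0| <= (1 + q) ^+ 2 * sigma ^+ 2 * norm2 A + eps * sigma ^+ 2.
Proof.
rewrite /B mulmxDr mulmxDl mxE; apply: le_trans (ler_normD _ _) _.
apply: lerD.
  rewrite !mulmxA -mulmxA -!mulmxA [s *m (_ *m _)]mulmxA.
  apply: le_trans (norm_form_le sL_le (vnorm2_mul_le (lexx _) Rt_le)) _.
  by rewrite le_eqVlt; apply/orP; left; apply/eqP; ring.
rewrite expr2 mulrA; exact: norm_form_le sE_le t_le.
Qed.

(** Interpolation errors: [e_a] in the kernel row at [x], [e_b] in the kernel column at [y], [e] in
    the value of the kernel. *)
Variables (e_a : 'rV[R]_r) (e_b : 'cV[R]_r) (e tau : R).
Hypotheses (ea_le : vnorm2 e_a^T <= tau) (eb_le : vnorm2 e_b <= tau)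
  (e_le : `|e| <= tau).
Let tau_ge0 : 0 <= tau. Proof. exact: le_trans (normr_ge0 _) e_le. Qed.

Let a := s *m lsubmx B + e_a.
Let b := usubmx B *m t + e_b.
(** This is [a *m invmx A] with [A] cancelled in the main term, so that [invmx A] is left only next
    to the small row [s *m lsubmx E + e_a]. *)
Let alpha :=
  s *m col_mx 1%:M S + (s *m lsubmx E + e_a) *m invmx A.

(** As [b] is [A] times [w = [I T^T] t] plus a small column, [alpha *m A *m w] removes the main term
    of [s *m B *m t]. In what remains, [invmx A], hidden in [alpha], stands between two small
    factors. *)
Lemma skeleton_residualE :
  s *m B *m t - a *m invmx A *m b
  = s *m E *m t - s *m lsubmx E *m (row_mx 1%:M T^T *m t)
    - e_a *m (row_mx 1%:M T^T *m t) - alpha *m (usubmx E *m t + e_b).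
Proof.
have -> : a *m invmx A = alpha.
  by rewrite /a lsubmx_skeleton mulmxDr -addrA mulmxDl mulmxA mulmxK.
have -> : b = A *m (row_mx 1%:M T^T *m t) + (usubmx E *m t + e_b).
  by rewrite /b usubmx_skeleton mulmxDl mulmxA addrA.
rewrite mulmxDr opprD addrA; congr (_ - _).
have -> : alpha *m (A *m (row_mx 1%:M T^T *m t))
    = (s *m col_mx 1%:M S *m A + (s *m lsubmx E + e_a))
       *m (row_mx 1%:M T^T *m t).
  by rewrite mulmxA /alpha mulmxDl mulmxKV.
rewrite /B mulmxDr mulmxDl !mulmxDl !mulmxA !opprD !addrA.
by rewrite [_ + s *m E *m t]addrC addrK.
Qed.

Lemma vnorm2_alpha_le :
  vnorm2 alpha^T <= (1 + q) * sigma + q ^+ 2 / eps * (eps * sigma + tau).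
Proof.
rewrite /alpha raddfD /=; apply: le_trans (vnorm2D _ _) _; apply: lerD => //.
rewrite trmx_mul; apply: le_trans (vnorm2_mulmx_tr _ _) _.
apply: ler_pM; rewrite ?norm2_ge0 ?vnorm2_ge0 //.
by rewrite raddfD; apply: le_trans (vnorm2D _ _) _; exact: lerD.
Qed.

Lemma skeleton_residual_le :
  `|(s *m B *m t) 0 0 + e - (a *m invmx A *m b) 0 0| <=
  eps * sigma ^+ 2 + tau + (eps * sigma + tau) * ((1 + q) * sigma)
  + ((1 + q) * sigma + q ^+ 2 / eps * (eps * sigma + tau)) * (eps * sigma + tau).
Proof.
have -> : (s *m B *m t) 0 0 + e - (a *m invmx A *m b) 0 0
    = e + (s *m B *m t - a *m invmx A *m b) 0 0.
  by rewrite !mxE; ring.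
rewrite skeleton_residualE.
have h1 : `|(s *m E *m t) 0 0| <= eps * sigma * sigma.
  exact: norm_form_le sE_le t_le.
have h2 := norm_form_le sEl_le Rt_le.
have h3 := norm_form_le ea_le Rt_le.
have h4 : vnorm2 (usubmx E *m t + e_b) <= eps * sigma + tau.
  by apply: le_trans (vnorm2D _ _) _; exact: lerD.
have h5 := norm_form_le vnorm2_alpha_le h4.
move: h1 h2 h3 h5 e_le.
set x1 := s *m E *m t; set x2 := s *m lsubmx E *m _; set x3 := e_a *m _.
set x4 := alpha *m _.
rewrite [(x1 - x2 - x3 - x4) 0 0]mxE [(x1 - x2 - x3) 0 0]mxE [(x1 - x2) 0 0]mxE.
rewrite [(- x2) 0 0]mxE [(- x3) 0 0]mxE [(- x4) 0 0]mxE !ler_norml.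
move: (x1 0 0) (x2 0 0) (x3 0 0) (x4 0 0) (_ * (_ + tau)).
move=> y1 y2 y3 y4 z; rewrite expr2 mulrA [(_ + tau) * _]mulrDl.
by move: (eps * sigma * sigma) => w; lra.
Qed.

Lemma skeleton_crude_le (u : 'rV[R]_r) (v : 'cV[R]_r) c :
  vnorm2 u^T <= c -> vnorm2 v <= c ->
  `|(u *m invmx A *m v) 0 0| <= c * (q ^+ 2 / eps * c).
Proof.
move=> uc vc; rewrite -mulmxA; apply: norm_form_le => //.
exact: vnorm2_mul_le.
Qed.

End Bounds.
End SkeletonResidual.

(** * Smooth kernels *)

Section Kernel.
Context {R : realType} {d : nat} (K : 'rV[R]_d -> 'rV[R]_d -> R).
Hypothesis K_smooth : smooth_kernel K.

Lemma smooth_kernel_continuous x y : cube R d x -> cube R d y ->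
  forall e : R, 0 < e -> exists2 h : R, 0 < h &
  forall x' y', cube R d x' -> cube R d y' ->
    (forall i, `|x' 0 i - x 0 i| < h) -> (forall i, `|y' 0 i - y 0 i| < h) ->
    `|K x' y' - K x y| < e.
Proof.
move=> xI yI e e0; have [U [f [_ cU fC Kf]]] := K_smooth.
have [fc _] := fC 0; have Uxy : U (x, y) by apply: cU; split.
have /cvgrPdist_lt/(_ _ e0) := fc _ Uxy.
move=> /nbhs_ballP[h /= h0 hf]; exists h => // x' y' x'I y'I xx' yy'.
rewrite !Kf // distrC; apply: hf; split; split=> //= i j; rewrite ord1.
  by rewrite /ball /= distrC xx'.
by rewrite /ball /= distrC yy'.
Qed.

Lemma smooth_kernel_bounded : exists2 C : R, 0 < C &
  forall x y, cube R d x -> cube R d y -> `|K x y| <= C.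
Proof.
have [U [f [_ cU fC Kf]]] := K_smooth; have [fc _] := fC 0.
have cc : compact (cube R d).
  rewrite (_ : cube R d = [set v | forall i, `[-1, 1]%classic (v ord0 i)]%classic).
    by apply: (@rV_compact R d (fun=> `[-1, 1]%classic)) => i;
      exact: segment_compact.
  by apply/seteqP; split=> v /= vI i; have := vI i; rewrite /= in_itv.
have : compact (f @` (cube R d `*` cube R d)%classic).
  apply: continuous_compact; last exact: compact_setX.
  by apply: continuous_in_subspaceT => p /set_mem pI; apply/fc/cU.
move=> /compact_bounded[M [_ HM]]; exists (`|M| + 1); first by rewrite ltr_wpDl.
move=> x y xI yI; rewrite Kf //; apply: (HM (`|M| + 1)); last by exists (x, y).
by rewrite (le_lt_trans (ler_norm M)) // ltrDl.
Qed.

Lemma weighted_kernel_mxE nX nY a b : weighted_kernel_mx K nX nY a b =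
  Num.sqrt (grid_weight R nX 0 a) * K (grid_point R a) (grid_point R b)
    * Num.sqrt (grid_weight R nY 0 b).
Proof.
by rewrite /weighted_kernel_mx mul_mx_diag mul_diag_mx !mxE.
Qed.

(** The dichotomy is applied to [K] as a function of [2d] coordinates. A massive grid is tested with
    the square roots of the weights restricted to the box; up to sign, the form is at least [c]
    times the masses of the two halves of the box, each at least [c ^ d]. *)
Lemma weighted_kernel_test : exists2 c : R, 0 < c & forall nX nY,
  (forall i, (0 < nX i)%N) -> (forall i, (0 < nY i)%N) ->
  weighted_kernel_mx K nX nY = 0 \/
  exists (u : 'rV[R]_(grid_size nX)) (v : 'cV[R]_(grid_size nY)),
    [/\ c <= `|(u *m weighted_kernel_mx K nX nY *m v) 0 0|,
        forall a, u 0 a ^+ 2 <= grid_weight R nX 0 a &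
        forall b, v b 0 ^+ 2 <= grid_weight R nY 0 b].
Proof.
pose G (z : 'I_d + 'I_d -> R) := K (\row_i z (inl i)) (\row_i z (inr i)).
have [x xI e e0|c c0 Hc] := @zero_or_massive_grid R _ G.
  have [||h h0 hK] := @smooth_kernel_continuous
    (\row_i x (inl i)) (\row_i x (inr i)) _ _ e e0; try by move=> i; rewrite mxE.
  exists h => // y yI yx; apply: hK => i; rewrite ?mxE //.
exists (c * (c ^+ d * c ^+ d)) => [|nX nY nX_gt0 nY_gt0].
  by rewrite !mulr_gt0 ?exprn_gt0.
pose n (l : 'I_d + 'I_d) := match l with inl i => nX i | inr i => nY i end.
pose co (a : 'I_(grid_size nX)) (b : 'I_(grid_size nY)) (l : 'I_d + 'I_d) :=
  match l with inl i => grid_coord a i | inr i => grid_coord b i end.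
have Kco a b : K (grid_point R a) (grid_point R b) = grid_val G n (co a b).
  by rewrite /grid_val /G; congr K; apply/rowP => i; rewrite !mxE.
have co_lt a b l : (co a b l < n l)%N by case: l => i; exact: grid_coord_lt.
have [|z|[sg [P [Pc Pw]]]] := Hc n; first by case.
  left; apply/matrixP => a b; rewrite weighted_kernel_mxE Kco z //.
  by rewrite mulr0 mul0r mxE.
right.
(* The indicator of a box, written as a product so that its mass factors over the directions. *)
pose chi m (Q : 'I_d -> pred nat) (a : 'I_(grid_size m)) : R :=
  \prod_(i < d) (Q i (grid_coord a i))%:R.
have chi01 m Q a : chi m Q a = [forall i, Q i (grid_coord a i)]%:R.
  rewrite /chi; case: forallP => [H|H]; first by rewrite big1 // => i _; rewrite H.
  have /existsP[i iQ] : [exists i, ~~ Q i (grid_coord a i)].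
    by rewrite -negb_forall; apply/forallP.
  by rewrite (bigD1 i) //= (negbTE iQ) mul0r.
have mass m (Q : 'I_d -> pred nat) :
    (forall i, c <= \sum_(j < m i | Q i j) cheb_weight R (m i) j) ->
    c ^+ d <= \sum_a grid_weight R m 0 a * chi m Q a.
  move=> Qc; under eq_bigr do rewrite grid_weightE -big_split /=.
  rewrite (sum_grid_prod m (fun i j => cheb_weight R (m i) j * (Q i j)%:R)).
  have -> : c ^+ d = \prod_(i < d) c by rewrite prodr_const card_ord.
  apply: ler_prod => i _; rewrite ltW //=; apply: le_trans (Qc i) _.
  rewrite big_mkcond; apply: ler_sum => j _.
  by case: ifP; rewrite ?mulr1 ?mulr0.
pose PX i := P (inl i); pose PY i := P (inr i).
have sqr_chi m Q (a : 'I_(grid_size m)) : (forall i, (0 < m i)%N) ->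
    (Num.sqrt (grid_weight R m 0 a) * chi m Q a) ^+ 2 <= grid_weight R m 0 a.
  move=> m0; have w0 : 0 <= grid_weight R m 0 a by rewrite ltW ?grid_weight_gt0.
  rewrite exprMn (sqr_sqrtr w0) chi01 ler_piMr //.
  by case: [forall _, _]; rewrite ?expr1n ?expr0n.
exists (\row_a (Num.sqrt (grid_weight R nX 0 a) * chi nX PX a)).
exists (\col_b (Num.sqrt (grid_weight R nY 0 b) * chi nY PY b)).
split=> [|a|b]; [|by rewrite mxE; exact: sqr_chi..].
apply: (@le_trans _ _ ((-1) ^+ sg * \sum_b (\sum_a
   (Num.sqrt (grid_weight R nX 0 a) * chi nX PX a)
    * weighted_kernel_mx K nX nY a b)
   * (Num.sqrt (grid_weight R nY 0 b) * chi nY PY b))); last first.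
  apply: le_trans (ler_norm _) _; rewrite normrM normrX normrN1 expr1n mul1r.
  rewrite le_eqVlt; apply/orP; left; apply/eqP; congr `|_|.
  rewrite [RHS]mxE.
  apply: eq_bigr => b _; rewrite !mxE; congr (_ * _).
  by apply: eq_bigr => a _; congr (_ * _); rewrite [RHS]mxE.
rewrite mulr_sumr.
apply: (@le_trans _ _ (\sum_b \sum_a c * ((grid_weight R nX 0 a * chi nX PX a)
  * (grid_weight R nY 0 b * chi nY PY b)))).
  rewrite exchange_big /=; under eq_bigr do rewrite -mulr_sumr -mulr_sumr.
  rewrite -mulr_sumr -mulr_suml ler_wpM2l ?(ltW c0) //.
  apply: ler_pM; rewrite ?exprn_ge0 ?(ltW c0) //; apply: mass => i.
    exact: (Pw (inl i)).
  exact: (Pw (inr i)).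
apply: ler_sum => b _; rewrite mulr_suml mulr_sumr; apply: ler_sum => a _.
rewrite weighted_kernel_mxE Kco.
have wa := grid_weight_gt0 nX_gt0 a (R := R).
have wb := grid_weight_gt0 nY_gt0 b (R := R).
rewrite -{1}(sqr_sqrtr (ltW wa)) -{1}(sqr_sqrtr (ltW wb)) !chi01.
case: forallP => [aP|_]; last by rewrite !(mulr0, mul0r).
case: forallP => [bP|_]; last by rewrite !(mulr0, mul0r).
have cK : c <= (-1) ^+ sg * grid_val G n (co a b).
  by apply: Pc => l; rewrite co_lt; case: l => i; [exact: aP|exact: bP].
set sa := Num.sqrt _; set sb := Num.sqrt _; set k := grid_val _ _ _ in cK *.
rewrite /= !mulr1 [leRHS](_ : _ = (-1) ^+ sg * k * (sa ^+ 2 * sb ^+ 2)).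
  by rewrite ler_wpM2r // mulr_ge0 ?sqr_ge0.
by ring.
Qed.

End Kernel.

(** * Weighted interpolation *)

Lemma vnorm2_entries (R : realType) n (v : 'cV[R]_n) c : 0 <= c ->
  (forall i, `|v i 0| <= c) -> vnorm2 v <= n%:R * c.
Proof.
move=> c0 vc; apply: vnorm2_le; first by rewrite mulr_ge0.
apply: (@le_trans _ _ (\sum_(i < n) c ^+ 2)).
  by apply: ler_sum => i _; rewrite -real_normK ?num_real // ler_sqr ?nnegrE.
rewrite sumr_const card_ord -[leLHS]mulr_natl exprMn ler_wpM2r ?sqr_ge0 //.
by rewrite -natrX ler_nat; case: (n) => // k; rewrite expnS expn1 leq_pmull.
Qed.

Section Permuted.
Context {R : realType} {M N m n : nat}.
Variables (sX : 'I_m -> 'I_M) (sY : 'I_n -> 'I_N).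

(** Bijectivity is asked of the summation index alone, so that [sY] can also enumerate just the
    selected columns. *)
Lemma mul_colsub_mxsub (u : 'rV[R]_M) (A : 'M[R]_(M, N)) : bijective sX ->
  colsub sX u *m mxsub sX sY A = colsub sY (u *m A).
Proof.
move=> bX; apply/rowP => j; rewrite !mxE (reindex sX (onW_bij _ bX)).
by apply: eq_bigr => i _; rewrite !mxE.
Qed.

Lemma mul_mxsub_rowsub (A : 'M[R]_(M, N)) (v : 'cV[R]_N) : bijective sY ->
  mxsub sX sY A *m rowsub sY v = rowsub sX (A *m v).
Proof.
move=> bY; apply/colP => i; rewrite !mxE (reindex sY (onW_bij _ bY)).
by apply: eq_bigr => j _; rewrite !mxE.
Qed.

Lemma mul_colsub_rowsub (u : 'rV[R]_N) (v : 'cV[R]_N) : bijective sY ->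
  colsub sY u *m rowsub sY v = u *m v.
Proof.
move=> bY; apply/matrixP => i j; rewrite !ord1 !mxE.
rewrite [RHS](reindex sY (onW_bij _ bY)).
by apply: eq_bigr => k _; rewrite !mxE.
Qed.

Lemma vnorm2_rowsub (v : 'cV[R]_N) : bijective sY ->
  vnorm2 (rowsub sY v) = vnorm2 v.
Proof.
move=> bY; rewrite /vnorm2 [in RHS](reindex sY (onW_bij _ bY)).
by congr Num.sqrt; apply: eq_bigr => i _; rewrite mxE.
Qed.

End Permuted.

Section WeightedInterpolation.
Context {R : realType} {d : nat} (K : 'rV[R]_d -> 'rV[R]_d -> R).
Implicit Types (n : 'I_d -> nat) (x y : 'rV[R]_d).

Definition sqrt_weight n := map_mx Num.sqrt (grid_weight R n).

(** The division compensates for the square roots of the weights in [weighted_kernel_mx]. *)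
Definition weighted_lagrange n x : 'rV[R]_(grid_size n) :=
  \row_a (lagrange_row n x 0 a / sqrt_weight n 0 a).

Lemma sqrt_weight_gt0 n a : (forall i, (0 < n i)%N) -> 0 < sqrt_weight n 0 a.
Proof. by move=> n0; rewrite mxE sqrtr_gt0 grid_weight_gt0. Qed.

Lemma weighted_lagrangeE n x : (forall i, (0 < n i)%N) ->
  weighted_lagrange n x *m diag_mx (sqrt_weight n) = lagrange_row n x.
Proof.
move=> n0; apply/rowP => a; rewrite mul_mx_diag mxE [X in X * _]mxE divfK //.
by rewrite gt_eqF ?sqrt_weight_gt0.
Qed.

Lemma lagrange_row_grid_point n b : (forall i, (0 < n i)%N) ->
  lagrange_row n (grid_point R b) = delta_mx 0 b.
Proof.
move=> n0; apply/rowP => a; rewrite !mxE eqxx /=; have [->|ab] := eqVneq a b.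
  rewrite big1 // => i _.
  by rewrite mxE lagrange1_node ?eqxx.
have /existsP[i ni] :
    [exists i, (enum_val a : grid_index n) i != (enum_val b : grid_index n) i].
  apply: contra_neqT ab => /existsPn H; apply: enum_val_inj; apply/ffunP => i.
  by have := H i; rewrite negbK => /eqP.
rewrite (bigD1 i) //= mxE lagrange1_node ?ltn_ord // eq_sym.
by rewrite (negbTE (_ : _ != _ :> nat)) ?mul0r.
Qed.

(** Each entry is at most [2 ^ d / sqrt w] with [w >= |grid| ^ -2] by [grid_weight_ge]; the other
    factor [|grid|] counts the entries. *)
Lemma vnorm2_weighted_lagrange n x : (forall i, (0 < n i)%N) -> cube R d x ->
  vnorm2 (weighted_lagrange n x)^T <= 2 ^+ d * (grid_size n)%:R ^+ 2.
Proof.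
move=> n0 xI; have M0 : 0 < (grid_size n)%:R :> R.
  by rewrite ltr0n (@grid_size_gt0 R).
rewrite expr2 mulrCA.
apply: vnorm2_entries => [|a]; first by rewrite mulr_ge0 ?exprn_ge0.
rewrite [_^T a 0]mxE [weighted_lagrange n x 0 a]mxE normrM.
rewrite [sqrt_weight n 0 a]mxE; apply: ler_pM => //; first exact: norm_lagrange_row_le.
rewrite normfV ger0_norm ?sqrtr_ge0 // -[leRHS]invrK lef_pV2 ?posrE ?invr_gt0 //.
  apply: le_trans (ler_wsqrtr (grid_weight_ge n0 a)).
  by rewrite -exprVn sqrtr_sqr ger0_norm ?invr_ge0 ?ler0n.
by rewrite sqrtr_gt0 grid_weight_gt0.
Qed.

Section Errors.
Variables (nX nY : 'I_d -> nat).
Hypotheses (nX_gt0 : forall i, (0 < nX i)%N) (nY_gt0 : forall i, (0 < nY i)%N).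
Let Kw := weighted_kernel_mx K nX nY.

Lemma weighted_lagrange_interp x y :
  (weighted_lagrange nX x *m Kw *m (weighted_lagrange nY y)^T) 0 0
  + interp_error K nX nY x y = K x y.
Proof.
rewrite /Kw /weighted_kernel_mx !mulmxA weighted_lagrangeE //.
rewrite -[_ *m diag_mx _ *m _]mulmxA -[X in _ *m (X *m _)]tr_diag_mx -trmx_mul.
by rewrite weighted_lagrangeE // addrC subrK.
Qed.

(** At a node the second Lagrange vector is a coordinate vector, so interpolation in [y] is exact
    there and only that in [x] remains. *)
Lemma weighted_row_interp x b :
  (weighted_lagrange nX x *m Kw) 0 b
    + interp_error K nX nY x (grid_point R b) * sqrt_weight nY 0 b
  = K x (grid_point R b) * sqrt_weight nY 0 b.
Proof.
rewrite /Kw /weighted_kernel_mx !mulmxA weighted_lagrangeE //.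
rewrite mul_mx_diag mxE -mulrDl; congr (_ * _); rewrite /interp_error.
rewrite lagrange_row_grid_point // trmx_delta -[X in (X *m _) 0 0]/(_ *m _).
by rewrite -colE [X in _ - X]mxE addrC subrK.
Qed.

Lemma weighted_col_interp a y :
  (Kw *m (weighted_lagrange nY y)^T) a 0
    + sqrt_weight nX 0 a * interp_error K nX nY (grid_point R a) y
  = sqrt_weight nX 0 a * K (grid_point R a) y.
Proof.
have wl : diag_mx (sqrt_weight nY) *m (weighted_lagrange nY y)^T
    = (lagrange_row nY y)^T.
  by rewrite -(weighted_lagrangeE _ nY_gt0) trmx_mul tr_diag_mx.
rewrite /Kw /weighted_kernel_mx -!mulmxA wl mul_diag_mx mxE -mulrDr.
congr (_ * _); rewrite /interp_error lagrange_row_grid_point //.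
by rewrite -mulmxA -rowE [X in _ - X]mxE addrC subrK.
Qed.

End Errors.
End WeightedInterpolation.

(** A product of square matrices is invertible only if its factors are; the weights then cancel, and
    the skeleton is the same with or without them. *)
Lemma skeleton_unweighted (R : realType) r (wx wy : 'rV[R]_r)
    (kx : 'rV[R]_r) (Kh : 'M[R]_r) (ky : 'cV[R]_r) :
  diag_mx wx *m Kh *m diag_mx wy \in unitmx ->
  kx *m invmx Kh *m ky = kx *m diag_mx wy
    *m invmx (diag_mx wx *m Kh *m diag_mx wy) *m (diag_mx wx *m ky).
Proof.
rewrite !unitmx_mul => /andP[/andP[ux uk] uy].
have -> : invmx (diag_mx wx *m Kh *m diag_mx wy)
    = invmx (diag_mx wy) *m invmx Kh *m invmx (diag_mx wx).
  set A := _ *m _ *m _; have uA : A \in unitmx by rewrite !unitmx_mul ux uk uy.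
  apply: (can_inj (mulKmx uA)); rewrite mulmxV // /A.
  by rewrite !mulmxA mulmxK // mulmxK // mulmxV.
by rewrite !mulmxA mulmxK // mulmxKV.
Qed.

(** The left side is that of [skeleton_residual_le] with [sigma := s] and [tau := k * eps]. A factor
    [eps] comes out, since [q ^+ 2 / eps] meets two of them. The term in [q ^+ 2] is at most
    [G ^+ 2 * (D * G ^+ 8) ^+ 2], whence the exponent 18. *)
Lemma skeleton_numeric (R : realType) (eps q rho C4 C5 s k : R) :
  0 < eps -> 0 <= q -> 0 <= rho -> 0 <= C4 -> 0 <= C5 -> 0 <= s -> 0 <= k ->
  let G := (1 + q) * (1 + rho) in let D := C4 + C5 in
  s <= C4 * G ^+ 8 -> k <= C5 * (1 + rho) ->
  eps * s ^+ 2 + k * eps + (eps * s + k * eps) * ((1 + q) * s)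
  + ((1 + q) * s + q ^+ 2 / eps * (eps * s + k * eps)) * (eps * s + k * eps)
  <= (4 * D ^+ 2 + D) * (eps * G ^+ 18).
Proof.
move=> e0 q0 rho0 C40 C50 s0 k0 G D sG kG.
have G1 : 1 <= G by rewrite /G; nra.
have qG : 1 + q <= G by rewrite /G; nra.
have rG : 1 + rho <= G by rewrite /G; nra.
have D0 : 0 <= D by rewrite addr_ge0.
have GX m n : (m <= n)%N -> G ^+ m <= G ^+ n by move=> mn; rewrite ler_weXn2l.
have G0 n : 0 <= G ^+ n by rewrite exprn_ge0 // (le_trans ler01).
have kG8 : k <= C5 * G ^+ 8.
  apply: le_trans kG _; rewrite ler_wpM2l //; apply: le_trans rG _.
  by rewrite -[leLHS]expr1 GX.
pose z := D * G ^+ 8.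
have skz : s + k <= z by rewrite /z /D mulrDl lerD.
have sz : s <= z by lra.
have z0 : 0 <= z by lra.
have -> : eps * s ^+ 2 + k * eps + (eps * s + k * eps) * ((1 + q) * s)
  + ((1 + q) * s + q ^+ 2 / eps * (eps * s + k * eps)) * (eps * s + k * eps)
  = eps * (s ^+ 2 + k + (s + k) * ((1 + q) * s)
     + ((1 + q) * s + q ^+ 2 * (s + k)) * (s + k)).
  by field; rewrite gt_eqF.
rewrite [leRHS]mulrCA ler_wpM2l ?(ltW e0) //.
have sk0 : 0 <= s + k by rewrite addr_ge0.
have q10 : 0 <= 1 + q by rewrite addr_ge0.
have t1 : s ^+ 2 <= D ^+ 2 * G ^+ 18.
  apply: (@le_trans _ _ (z ^+ 2)); first by rewrite ler_sqr ?nnegrE.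
  by rewrite /z exprMn -exprM ler_wpM2l ?sqr_ge0 ?GX.
have t2 : k <= D * G ^+ 18.
  apply: le_trans (_ : z <= _); first by lra.
  by rewrite /z ler_wpM2l ?GX.
have t3 : (s + k) * ((1 + q) * s) <= D ^+ 2 * G ^+ 18.
  apply: (@le_trans _ _ (z * (G * z))).
    by apply: ler_pM; rewrite ?mulr_ge0 //; apply: ler_pM.
  have -> : z * (G * z) = D ^+ 2 * G ^+ 17 by rewrite /z; ring.
  by rewrite ler_wpM2l ?sqr_ge0 ?GX.
have t4 : (1 + q) * s * (s + k) <= D ^+ 2 * G ^+ 18 by rewrite mulrC.
have t5 : q ^+ 2 * (s + k) * (s + k) <= D ^+ 2 * G ^+ 18.
  apply: (@le_trans _ _ (G ^+ 2 * z * z)).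
    apply: ler_pM; rewrite ?mulr_ge0 ?sqr_ge0 //; apply: ler_pM; rewrite ?sqr_ge0 //.
    by rewrite ler_sqr ?nnegrE; lra.
  by rewrite le_eqVlt; apply/orP; left; apply/eqP; rewrite /z; ring.
by rewrite [_ * (s + k)]mulrDl; move: t1 t2 t3 t4 t5; lra.
Qed.

(** As [eps >= e0], both [1 <= eps / e0] and [eps^-1 <= eps / e0 ^+ 2] hold, which turns a bound in
    [1 / eps] into a multiple of [eps]. The exponent 18 is that of [skeleton_numeric]. *)
Lemma crude_numeric (R : realType) (eps q rho C e0 w : R) :
  0 < e0 -> e0 <= eps -> 0 <= q -> 0 <= rho -> 0 <= C -> 0 <= w ->
  C + rho * (C * w) * (q ^+ 2 / eps * (rho * (C * w)))
  <= (C / e0 + (C * w) ^+ 2 / e0 ^+ 2) * (eps * ((1 + q) * (1 + rho)) ^+ 18).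
Proof.
move=> e00 e0eps q0 rho0 C0 w0; set G := (1 + q) * (1 + rho).
have eps0 : 0 < eps by apply: lt_le_trans e0eps.
have G1 : 1 <= G by rewrite /G; nra.
have qrG : rho * q <= G by rewrite /G; nra.
have e1 : 1 <= eps / e0 by rewrite ler_pdivlMr // mul1r.
have e2 : eps^-1 <= eps / e0 ^+ 2.
  rewrite -[leLHS]mulr1 ler_pdivrMl //.
  have -> : eps * (eps / e0 ^+ 2) = (eps / e0) ^+ 2 by field; rewrite gt_eqF.
  by rewrite exprn_ege1.
have G18 : 1 <= G ^+ 18 by rewrite exprn_ege1.
have G2 : (rho * q) ^+ 2 <= G ^+ 18.
  apply: (@le_trans _ _ (G ^+ 2)); last by rewrite ler_weXn2l.
  by rewrite ler_sqr ?nnegrE ?mulr_ge0 //; lra.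
rewrite mulrDl; apply: lerD.
  rewrite [leRHS](_ : _ = C * (eps / e0 * G ^+ 18)); last by field; rewrite gt_eqF.
  by rewrite ler_peMr // -[leLHS]mulr1; apply: ler_pM.
have -> : rho * (C * w) * (q ^+ 2 / eps * (rho * (C * w)))
   = (C * w) ^+ 2 * (eps^-1 * (rho * q) ^+ 2) by field; rewrite gt_eqF.
have -> : (C * w) ^+ 2 / e0 ^+ 2 * (eps * G ^+ 18)
   = (C * w) ^+ 2 * (eps / e0 ^+ 2 * G ^+ 18) by field; rewrite gt_eqF.
rewrite ler_wpM2l ?sqr_ge0 //.
by apply: ler_pM; rewrite ?sqr_ge0 ?invr_ge0 ?(ltW eps0).
Qed.

(** * The selected rows and columns *)

Section Selection.
Context {R : realType} {d : nat} (K : 'rV[R]_d -> 'rV[R]_d -> R).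
Context (CK : R) (CK_gt0 : 0 < CK)
  (K_le : forall x y, cube R d x -> cube R d y -> `|K x y| <= CK).
Context (nX nY : 'I_d -> nat).
Context (nX_gt0 : forall i, (0 < nX i)%N) (nY_gt0 : forall i, (0 < nY i)%N).
Context (r mX mY : nat).
Context (sX : 'I_(r + mX) -> 'I_(grid_size nX)).
Context (sY : 'I_(r + mY) -> 'I_(grid_size nY)).
Context (sX_bij : bijective sX) (sY_bij : bijective sY).
Let Kw := weighted_kernel_mx K nX nY.
Let B := mxsub sX sY Kw.
Let A := ulsubmx B.
Context (S : 'M[R]_(mX, r)) (T : 'M[R]_(mY, r)) (E : 'M[R]_(r + mX, r + mY)).
Context (q eps : R) (eps_gt0 : 0 < eps).
Context (BE : B = col_mx 1%:M S *m A *m row_mx 1%:M T^T + E).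
Context (epsE : eps = norm2 E) (S_le : norm2 S <= q) (T_le : norm2 T <= q).
Context (A_unit : A \in unitmx) (Ainv_le : norm2 (invmx A) <= q ^+ 2 / eps).

Let W : R := pi ^+ d.
Let M : R := (grid_size nX)%:R.
Let N : R := (grid_size nY)%:R.
Let G : R := (1 + q) * (1 + r%:R).
Let Xhat := selected_points R sX.
Let Yhat := selected_points R sY.

Let E_le : norm2 E <= eps. Proof. by rewrite epsE. Qed.
Let q_ge0 : 0 <= q. Proof. exact: le_trans (norm2_ge0 S) S_le. Qed.
Let W_ge1 : 1 <= W.
Proof. by rewrite exprn_ege1 // (le_trans _ (pi_ge2 R)) // ler1n. Qed.
Let W_gt0 : 0 < W. Proof. exact: lt_le_trans ltr01 W_ge1. Qed.
Let M_ge1 : 1 <= M.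
Proof. by rewrite ler1n; exact: (@grid_size_gt0 R). Qed.
Let N_ge1 : 1 <= N.
Proof. by rewrite ler1n; exact: (@grid_size_gt0 R). Qed.

(** A zero matrix would have zero remainder [E], hence [eps = 0]. This excludes the first
    alternative of [weighted_kernel_test]. *)
Lemma weighted_selection_neq0 : Kw != 0.
Proof.
apply/eqP => Kw0; have B0 : B = 0 by apply/matrixP => i j; rewrite mxE Kw0 !mxE.
have E0 : E = 0.
  move: BE; rewrite /A B0 => /esym.
  have -> : ulsubmx (0 : 'M[R]_(r + mX, r + mY)) = 0.
    by apply/matrixP => i j; rewrite !mxE.
  by rewrite mulmx0 mul0mx add0r.
have : norm2 E <= 0.
  by apply: norm2_le => // v; rewrite E0 mul0mx vnorm2_0 mul0r.
by rewrite -epsE leNgt eps_gt0.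
Qed.

Lemma sqrt_weight_le n a : (forall i, (0 < n i)%N) ->
  @sqrt_weight R d n 0 a <= W.
Proof.
move=> n0; apply: (@le_trans _ _ (Num.sqrt (W ^+ 2))); last first.
  by rewrite sqrtr_sqr ger0_norm // ltW.
rewrite mxE ler_wsqrtr //; apply: le_trans (grid_weight_le n0 a) _.
rewrite ler_pdivrMr ?ltr0n ?(@grid_size_gt0 R) //.
rewrite expr2 -mulrA ler_peMr ?(ltW W_gt0) //.
rewrite -[leLHS]mulr1; apply: ler_pM => //.
by rewrite ler1n (@grid_size_gt0 R).
Qed.

(** The weights contribute at most [sqrt (W / M) * sqrt (W / N)] to each entry, and an [r] by [r]
    matrix has norm at most [r] times its largest entry. *)
Lemma norm2_weighted_selection_le : norm2 A <= r%:R * CK * W / Num.sqrt (M * N).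
Proof.
have M0 : 0 < M by apply: lt_le_trans M_ge1.
have N0 : 0 < N by apply: lt_le_trans N_ge1.
have -> : r%:R * CK * W / Num.sqrt (M * N)
    = Num.sqrt (r * r)%:R * (CK * W / Num.sqrt (M * N)).
  by rewrite natrM -expr2 sqrtr_sqr ger0_norm // !mulrA.
apply: norm2_entries => [|i j].
  by rewrite mulr_ge0 ?invr_ge0 ?sqrtr_ge0 // mulr_ge0 // ltW.
have -> : A i j = Kw (sX (lshift mX i)) (sY (lshift mY j)) by rewrite !mxE.
rewrite weighted_kernel_mxE !normrM !(ger0_norm (sqrtr_ge0 _)).
rewrite mulrAC mulrC -[leRHS]mulrA.
apply: ler_pM; rewrite ?mulr_ge0 ?sqrtr_ge0 //.
  by apply: K_le; exact: cube_grid_point.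
have -> : W / Num.sqrt (M * N) = Num.sqrt (W / M) * Num.sqrt (W / N).
  rewrite -sqrtrM ?divr_ge0 ?(ltW W_gt0) ?(ltW M0) //.
  rewrite mulrACA -invfM -expr2 [in RHS]sqrtrM ?sqr_ge0 //.
  rewrite sqrtr_sqr ger0_norm ?(ltW W_gt0) //.
  by rewrite sqrtrV // mulr_ge0 // ltW.
by apply: ler_pM; rewrite ?sqrtr_ge0 // ler_wsqrtr ?grid_weight_le.
Qed.

(** The form is at least [c] and, by [norm_form_B_le], at most [(1 + q)^2 W^2 |A| + eps W^2]. If the
    last term is at most [c / 2], then [|A|] is bounded below, and its decay in [M * N] bounds the
    grids. *)
Lemma grid_sizes_le (c : R) (u : 'rV[R]_(grid_size nX))
    (v : 'cV[R]_(grid_size nY)) :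
  0 < c -> c <= `|(u *m Kw *m v) 0 0| ->
  (forall a, u 0 a ^+ 2 <= grid_weight R nX 0 a) ->
  (forall b, v b 0 ^+ 2 <= grid_weight R nY 0 b) ->
  c / (2 * W ^+ 2) <= eps \/ M * N <= (2 * CK * W ^+ 3 / c) ^+ 2 * G ^+ 4.
Proof.
move=> c0 cu uw vw.
(* The squared length is at most the total weight, hence at most [W <= W ^+ 2]. *)
have norm_le (n : 'I_d -> nat) (z : 'cV[R]_(grid_size n)) :
    (forall i, (0 < n i)%N) -> (forall a, z a 0 ^+ 2 <= grid_weight R n 0 a) -> vnorm2 z <= W.
  move=> n0 zw; apply: vnorm2_le; first exact: ltW.
  apply: (@le_trans _ _ W); last by rewrite -[leLHS]expr1 ler_weXn2l.
  by apply: le_trans (sum_grid_weight_le n0); apply: ler_sum => a _.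
have uW : vnorm2 (colsub sX u)^T <= W.
  rewrite trmx_mxsub -[mxsub _ _ _]/(rowsub sX u^T) vnorm2_rowsub //.
  by apply: norm_le => // a; rewrite mxE.
have vW : vnorm2 (rowsub sY v) <= W by rewrite vnorm2_rowsub // norm_le.
have form : u *m Kw *m v = colsub sX u *m B *m rowsub sY v.
  by rewrite mul_colsub_mxsub // mul_colsub_rowsub.
move: cu; rewrite form BE => cu.
have {}cu := le_trans cu (norm_form_B_le A S_le T_le E_le uW vW).
have [eps_le|eps_gt] := leP (c / (2 * W ^+ 2)) eps; [by left|right].
have W20 : 0 < W ^+ 2 by rewrite exprn_gt0.
have c2 : eps * W ^+ 2 <= c / 2.
  rewrite -ler_pdivlMr //; apply: le_trans (ltW eps_gt) _.
  by rewrite le_eqVlt; apply/orP; left; apply/eqP; field; rewrite gt_eqF.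
set X := M * N; have X0 : 0 < X by rewrite mulr_gt0 ?(lt_le_trans ltr01).
have sX0 : 0 < Num.sqrt X by rewrite sqrtr_gt0.
have key : Num.sqrt X <= 2 * CK * W ^+ 3 / c * G ^+ 2.
  have h : c / 2 <= (1 + q) ^+ 2 * W ^+ 2 * (r%:R * CK * W / Num.sqrt X).
    apply: (@le_trans _ _ ((1 + q) ^+ 2 * W ^+ 2 * norm2 A)); first by lra.
    apply: ler_wpM2l; first by rewrite mulr_ge0 ?sqr_ge0.
    exact: norm2_weighted_selection_le.
  rewrite mulrA ler_pdivlMr // in h.
  rewrite [leRHS]mulrAC ler_pdivlMr //.
  have -> : G ^+ 2 = (1 + q) ^+ 2 * (1 + r%:R) ^+ 2 by rewrite exprMn.
  have h2 : r%:R <= (1 + r%:R) ^+ 2 :> R by have : 0 <= r%:R :> R by []; nra.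
  apply: (@le_trans _ _ (2 * CK * W ^+ 3 * ((1 + q) ^+ 2 * r%:R))).
    by lra.
  have [CK0 W0] := (ltW CK_gt0, ltW W_gt0).
  apply: ler_wpM2l; first by apply: mulr_ge0; [exact: mulr_ge0|exact: exprn_ge0].
  by rewrite ler_wpM2l ?sqr_ge0.
rewrite -[leLHS](sqr_sqrtr (ltW X0)).
have -> : G ^+ 4 = (G ^+ 2) ^+ 2 by rewrite -exprM.
rewrite -exprMn ler_sqr // nnegrE ?sqrtr_ge0 //.
exact: le_trans (ltW sX0) key.
Qed.

Let wX : 'rV[R]_r := \row_i sqrt_weight nX 0 (sX (lshift mX i)).
Let wY : 'rV[R]_r := \row_j sqrt_weight nY 0 (sY (lshift mY j)).
Let kx x := kernel_mx K (fun _ : 'I_1 => x) Yhat.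
Let ky y := kernel_mx K Xhat (fun _ : 'I_1 => y).

Lemma weighted_selectionE : A = diag_mx wX *m kernel_mx K Xhat Yhat *m diag_mx wY.
Proof.
apply/matrixP => i j.
have -> : A i j = Kw (sX (lshift mX i)) (sY (lshift mY j)) by rewrite !mxE.
by rewrite weighted_kernel_mxE mul_mx_diag mul_diag_mx !mxE.
Qed.

(** The last row plays the part of [e_a] in [skeleton_residual_le]. *)
Lemma weighted_row_selection x :
  kx x *m diag_mx wY
  = colsub sX (weighted_lagrange nX x) *m lsubmx B
    + \row_j (interp_error K nX nY x (Yhat j) * wY 0 j).
Proof.
have -> : lsubmx B = mxsub sX (sY \o lshift mY) Kw.
  by apply/matrixP => i j; rewrite !mxE.
rewrite mul_colsub_mxsub //; apply/rowP => j.
rewrite mul_mx_diag [RHS]mxE [colsub _ _ 0 j]mxE [(\row__ _) 0 j in RHS]mxE.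
rewrite [wY 0 j]mxE weighted_row_interp // [LHS]mxE.
by congr (_ * _); rewrite mxE.
Qed.

Lemma weighted_col_selection y :
  diag_mx wX *m ky y
  = usubmx B *m rowsub sY (weighted_lagrange nY y)^T
    + \col_i (wX 0 i * interp_error K nX nY (Xhat i) y).
Proof.
have -> : usubmx B = mxsub (sX \o lshift mX) sY Kw.
  by apply/matrixP => i j; rewrite !mxE.
rewrite mul_mxsub_rowsub //; apply/colP => i.
rewrite mul_diag_mx [RHS]mxE [rowsub _ _ i 0]mxE [(\col__ _) i 0 in RHS]mxE.
rewrite [wX 0 i]mxE weighted_col_interp // [LHS]mxE.
by congr (_ * _); rewrite mxE.
Qed.

(** The two terms are bounded separately, without any cancellation; this is enough when [eps] is
    bounded below. *)
Lemma skeleton_crude_error x y : cube R d x -> cube R d y ->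
  `|K x y - (kx x *m invmx (kernel_mx K Xhat Yhat) *m ky y) 0 0|
  <= CK + r%:R * (CK * W) * (q ^+ 2 / eps * (r%:R * (CK * W))).
Proof.
move=> xI yI; apply: le_trans (ler_normB _ _) _; apply: lerD; first exact: K_le.
rewrite (@skeleton_unweighted _ _ wX wY) -?weighted_selectionE //.
have [CK0 W0] := (ltW CK_gt0, ltW W_gt0).
apply: skeleton_crude_le => //; apply: vnorm2_entries => [|i];
  rewrite ?mulr_ge0 //.
  rewrite mxE mul_mx_diag !mxE normrM; apply: ler_pM => //.
    by apply: K_le => //; exact: cube_grid_point.
  rewrite ger0_norm ?sqrtr_ge0 //.
  have := @sqrt_weight_le nY (sY (lshift mY i)) nY_gt0.
  by rewrite !mxE.
rewrite mul_diag_mx !mxE normrM mulrC; apply: ler_pM => //.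
  by apply: K_le => //; exact: cube_grid_point.
rewrite ger0_norm ?sqrtr_ge0 //.
have := @sqrt_weight_le nX (sX (lshift mX i)) nX_gt0.
by rewrite !mxE.
Qed.

Lemma skeleton_fine_error (Cint C3 D : R) x y :
  D = 2 ^+ d * C3 ^+ 4 + Cint * W -> 0 < Cint -> 0 <= C3 ->
  (forall x y, cube R d x -> cube R d y ->
     `|interp_error K nX nY x y| <= Cint * eps) ->
  M * N <= C3 ^+ 2 * G ^+ 4 -> cube R d x -> cube R d y ->
  `|K x y - (kx x *m invmx (kernel_mx K Xhat Yhat) *m ky y) 0 0|
  <= (4 * D ^+ 2 + D) * (eps * G ^+ 18).
Proof.
move=> -> Cint0 C30 err MN xI yI.
have [W0 M0 N0] : [/\ 0 <= W, 0 <= M & 0 <= N].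
  by split; [exact: ltW|exact: ler0n|exact: ler0n].
have Ci0 := ltW Cint0.
have MN0 : 0 <= M * N by rewrite mulr_ge0.
(* [k * eps] bounds the errors of the [r] weighted entries taken together, at most [Cint * eps * W]
   each, as well as the scalar error. *)
pose k := Cint * W * (1 + r%:R).
(* Since [M] and [N] are at least 1, this bounds both weighted Lagrange vectors, of lengths at most
   [2 ^ d M^2] and [2 ^ d N^2]. *)
pose s := 2 ^+ d * (M * N) ^+ 2.
have k0 : 0 <= k by rewrite /k !mulr_ge0 // addr_ge0.
have s0 : 0 <= s by rewrite /s mulr_ge0 ?exprn_ge0.
have s_le : s <= 2 ^+ d * C3 ^+ 4 * G ^+ 8.
  rewrite /s -mulrA ler_wpM2l ?exprn_ge0 //.
  have -> : C3 ^+ 4 * G ^+ 8 = (C3 ^+ 2 * G ^+ 4) ^+ 2 by ring.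
  by rewrite ler_sqr // nnegrE (le_trans MN0).
apply: le_trans (skeleton_numeric (s := s) (k := k) eps_gt0 q_ge0 (ler0n R r)
  _ _ s0 k0 s_le (lexx _)); last 2 first.
- by rewrite mulr_ge0 ?exprn_ge0.
- by rewrite mulr_ge0.
rewrite (@skeleton_unweighted _ _ wX wY) -?weighted_selectionE //.
rewrite -(weighted_lagrange_interp K nX_gt0 nY_gt0 x y).
rewrite weighted_row_selection weighted_col_selection.
have -> : weighted_lagrange nX x *m weighted_kernel_mx K nX nY
    *m (weighted_lagrange nY y)^T
  = colsub sX (weighted_lagrange nX x) *m B
    *m rowsub sY (weighted_lagrange nY y)^T.
  by rewrite mul_colsub_mxsub // mul_colsub_rowsub.
have wYle j : `|wY 0 j| <= W.
  by rewrite mxE ger0_norm ?sqrt_weight_le // ltW // sqrt_weight_gt0.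
have wXle j : `|wX 0 j| <= W.
  by rewrite mxE ger0_norm ?sqrt_weight_le // ltW // sqrt_weight_gt0.
have CeW : 0 <= Cint * eps * W by rewrite !mulr_ge0 // ltW.
have kE : k * eps = r%:R * (Cint * eps * W) + Cint * eps * W.
  by rewrite /k; ring.
have rk : r%:R * (Cint * eps * W) <= k * eps by rewrite kE lerDl.
have ek : Cint * eps <= k * eps.
  rewrite kE; apply: (@le_trans _ _ (Cint * eps * W)); last by rewrite lerDr mulr_ge0.
  by rewrite ler_peMr // mulr_ge0 // ltW.
have sX_le : vnorm2 (colsub sX (weighted_lagrange nX x))^T <= s.
  rewrite trmx_mxsub -[mxsub _ _ _]/(rowsub sX _) vnorm2_rowsub //.
  apply: le_trans (vnorm2_weighted_lagrange nX_gt0 xI) _.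
  rewrite /s ler_wpM2l ?exprn_ge0 // ler_sqr ?nnegrE //.
  by rewrite -[leLHS]mulr1 ler_wpM2l.
have sY_le : vnorm2 (rowsub sY (weighted_lagrange nY y)^T) <= s.
  rewrite vnorm2_rowsub //.
  apply: le_trans (vnorm2_weighted_lagrange nY_gt0 yI) _.
  rewrite /s ler_wpM2l ?exprn_ge0 // ler_sqr ?nnegrE //.
  by rewrite -[leLHS]mul1r ler_wpM2r.
rewrite BE; apply: skeleton_residual_le => //; last first.
- exact: le_trans (err _ _ xI yI) ek.
- apply: le_trans rk; apply: vnorm2_entries => // i; rewrite mxE normrM mulrC.
  by apply: ler_pM => //; apply: err => //; exact: cube_grid_point.
- apply: le_trans rk; apply: vnorm2_entries => // i; rewrite mxE mxE normrM.
  by apply: ler_pM => //; apply: err => //; exact: cube_grid_point.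
Qed.

End Selection.
Unset Implicit Arguments.

Theorem theorem2p4 (R : realType) (d : nat) (d_gt0 : (0 < d)%N)
    (K : 'rV[R]_d -> 'rV[R]_d -> R) (K_smooth : smooth_kernel K)
    (p : {poly {poly R}}) (Cint : R) (Cint_gt0 : 0 < Cint) :
  exists (r : {poly {poly R}}) (C : R), 0 < C /\
  forall (nX nY : 'I_d -> nat) (delta eps : R) (r1 mX mY : nat)
      (sX : 'I_(r1 + mX) -> 'I_(grid_size nX))
      (sY : 'I_(r1 + mY) -> 'I_(grid_size nY)),
    let r0 := minn (grid_size nX) (grid_size nY) in
    let Xhat := selected_points R sX in
    let Yhat := selected_points R sY in
    (forall i, (0 < nX i)%N) -> (forall i, (0 < nY i)%N) ->
    0 <= delta ->
    (forall x y, cube R d x -> cube R d y ->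
       `|interp_error K nX nY x y| <= Cint * delta) ->
    strong_rr_selection (weighted_kernel_mx K nX nY) p.[r0%:R, r1%:R] eps
      sX sY ->
    delta < eps ->
    forall x y, cube R d x -> cube R d y ->
      `|K x y - (kernel_mx K (fun _ : 'I_1 => x) Yhat
                 *m invmx (kernel_mx K Xhat Yhat)
                 *m kernel_mx K Xhat (fun _ : 'I_1 => y)) 0 0|
      <= C * (eps * r.[r0%:R, r1%:R]).
Proof.
have [CK CK0 K_le] := smooth_kernel_bounded K_smooth.
have [c c0 test] := weighted_kernel_test K_smooth.
pose W : R := pi ^+ d.
have W0 : 0 < W by rewrite exprn_gt0 ?pi_gt0.
pose C3 := 2 * CK * W ^+ 3 / c.
have C30 : 0 <= C3.
  apply: divr_ge0; last exact: ltW.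
  apply: mulr_ge0; last by apply: exprn_ge0; exact: ltW.
  by apply: mulr_ge0 => //; exact: ltW.
pose D := 2 ^+ d * C3 ^+ 4 + Cint * W.
have D0 : 0 < D.
  by rewrite ltr_wpDl ?mulr_gt0 // mulr_ge0 ?exprn_ge0.
pose e0 := c / (2 * W ^+ 2).
have e00 : 0 < e0.
  by apply: divr_gt0 => //; apply: mulr_gt0 => //; exact: exprn_gt0.
pose C1 := 4 * D ^+ 2 + D.
have C10 : 0 < C1.
  by apply: ltr_wpDl => //; apply: mulr_ge0 => //; exact: sqr_ge0.
pose C2 := CK / e0 + (CK * W) ^+ 2 / e0 ^+ 2.
have C20 : 0 < C2.
  apply: addr_gt0; first exact: divr_gt0.
  by apply: divr_gt0; apply: exprn_gt0 => //; exact: mulr_gt0.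
(* ['X%:P] is the second variable, evaluated at [r1]. [C1] serves the bounded grids and [C2] the
   case [eps >= e0]. *)
exists (((1 + p) * (1 + 'X%:P)) ^+ 18), (C1 + C2); split.
  by rewrite addr_gt0.
move=> nX nY delta eps r1 mX mY sX sY r0 Xhat Yhat nX0 nY0 delta0 err.
move=> [bX bY [S [T [E [BE [epsE _] [Sq Tq] [Au Ainv]]]]]] de x y xI yI.
have eps0 : 0 < eps by exact: le_lt_trans de.
set q := p.[_, _] in Sq Tq Ainv *.
have q0 : 0 <= q := le_trans (norm2_ge0 S) Sq.
have -> : (((1 + p) * (1 + 'X%:P)) ^+ 18).[r0%:R, r1%:R]
    = ((1 + q) * (1 + r1%:R)) ^+ 18 by rewrite !hornerE.
(* Here [delta < eps] makes the interpolation error commensurate with [eps]. *)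
have err' x' y' : cube R d x' -> cube R d y' ->
    `|interp_error K nX nY x' y'| <= Cint * eps.
  by move=> x'I y'I; apply: le_trans (err _ _ x'I y'I) _; rewrite ler_pM2l // ltW.
have eG0 : 0 <= eps * ((1 + q) * (1 + r1%:R)) ^+ 18.
  by rewrite mulr_ge0 ?(ltW eps0) // exprn_ge0 // mulr_ge0 // addr_ge0.
have [Kw0|[u [v [cu uw vw]]]] := test nX nY nX0 nY0.
  by have := weighted_selection_neq0 eps0 BE epsE; rewrite Kw0 eqxx.
(* If [eps >= e0], the crude bound is still a multiple of [eps]; otherwise the grid sizes are under
   control and the residual formula applies. *)
have [eps_ge|MN] :=
  grid_sizes_le CK0 K_le nX0 nY0 bX bY BE epsE Sq Tq c0 cu uw vw.
  apply: (@le_trans _ _ (C2 * (eps * ((1 + q) * (1 + r1%:R)) ^+ 18)));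
    last by rewrite ler_wpM2r // lerDr ltW.
  apply: le_trans (crude_numeric e00 eps_ge q0 (ler0n R r1) (ltW CK0) (ltW W0)).
  exact: skeleton_crude_error.
apply: (@le_trans _ _ (C1 * (eps * ((1 + q) * (1 + r1%:R)) ^+ 18)));
    last by rewrite ler_wpM2r // lerDl ltW.
exact: (skeleton_fine_error nX0 nY0 bX bY eps0 BE epsE Sq Tq Au Ainv
  erefl Cint_gt0 C30 err' MN).
Qed.
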